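(* Assume the Hardy-Littlewood Conjecture. Let $\alpha$ be an integer with $\alpha\equiv 1\pmod 4$ and let $D=\pm 2^\sigma p_1\cdots p_r(q_1\cdots q_s)^2(l_1\cdots l_t)^3$ be as in the context, with $\gcd(D,\alpha)=1$. If $D\equiv 1\pmod 4$, then $$\mathrm{dens}_D(2\alpha)=\frac14\left(1+\frac{(-1)^{r+t}}{\tau(p_1\cdots p_rl_1\cdots l_t)}+\frac{2(-1)^{r_1+r_7+s+t_1+t_7}}{\tau(p_1\cdots p_rq_1\cdots q_sl_1\cdots l_t)}\right),$$ $$\mathrm{dens}_D(-2\alpha)=\frac14\left(1+\frac{(-1)^{r+t}}{\tau(p_1\cdots p_rl_1\cdots l_t)}-\frac{2(-1)^{r_1+r_7+s+t_1+t_7}}{\tau(p_1\cdots p_rq_1\cdots q_sl_1\cdots l_t)}\right).$$ If $D\equiv 3\pmod 4$, then $$\mathrm{dens}_D(2\alpha)=\mathrm{dens}_D(-2\alpha)=\frac14\left(1+\frac{(-1)^{r+t}}{\tau(p_1\cdots p_rl_1\cdots l_t)}\right).$$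
   Context: $D=\pm 2^\sigma p_1\cdots p_r(q_1\cdots q_s)^2(l_1\cdots l_t)^3$ with $\sigma\in\{0,1,2,3\}$, $r,s,t\ge0$, and the $p_i,q_i,l_i$ pairwise distinct odd primes (every $E_D$ is isomorphic to one with $D$ of this form). $r_i$ is the number of primes among $p_1,\dots,p_r$ congruent to $i$ mod $8$, and $t_i$ the number of primes among $l_1,\dots,l_t$ congruent to $i$ mod $8$. On odd squarefree positive integers, $\tau(n)=\prod_{l\mid n}\tau(l)$ with $\tau(l)=l$ if $l\equiv3\pmod4$, $\tau(l)=l-2$ if $l\equiv1\pmod4$, and $\tau(1)=1$. For a nonzero integer $D$, $E_D$ is the elliptic curve $y^2=x^3+Dx$, and for a prime $p\nmid 2D$, $a_p(E_D)=1+p-\#\tilde E_D(\mathbb{F}_p)$. For a nonzero integer $m$ put $Q(m,N)=\{p \text{ prime}: p=m^2+x^2\le N \text{ for some } x\in\mathbb{Z}\}$ and $$\mathrm{dens}_D(2m)=\lim_{N\to\infty}\frac{\#\{p\in Q(m,N): p\nmid 2D,\ a_p(E_D)=2m\}}{\#Q(m,N)}$$ (denoted $a_p(2m)$ in the paper); the claim includes that the limits exist. Hardy-Littlewood Conjecture: for all integers $a,b,c$ with $a>0$, $\gcd(a,b,c)=1$, $a+b$ and $c$ not both even, and $\Delta=b^2-4ac$ not a perfect square, the number $P(n)$ of primes less than $n$ of the form $ax^2+bx+c$ (with $x$ a nonnegative integer) satisfies $P(n)\sim\delta(a,b,c)\frac{\sqrt{n}}{\log n}$ as $n\to\infty$,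 where $$\delta(a,b,c)=\frac{\gcd(2,a+b)}{\sqrt{a}}\prod_{p\mid a,\ p\mid b,\ p>2}\frac{p}{p-1}\ \prod_{p\nmid a,\ p>2}\left(1-\frac{\left(\frac{\Delta}{p}\right)}{p-1}\right),$$ the products being over primes (the second taken in increasing order of $p$) and $\left(\frac{\cdot}{p}\right)$ being the Legendre symbol. *)

(* Defs.v *)
From mathcomp Require Import all_boot all_order all_algebra.
From mathcomp Require Import all_classical all_reals all_analysis.
Set Implicit Arguments.
Unset Strict Implicit.
Unset Printing Implicit Defensive.
Import Order.TTheory GRing.Theory Num.Theory.
Import numFieldNormedType.Exports.
Local Open Scope classical_set_scope.
Local Open Scope ring_scope.

(* Number of elements of A that are strictly smaller than n. *)
Definition count_below (A : set nat) (n : nat) : nat :=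
  #|[pred k : 'I_n | (k : nat) \in A]|.

(* Legendre symbol; meaningful for p an odd prime. *)
Definition legendre (a : int) (p : nat) : int :=
  if (p%:Z %| a)%Z then 0
  else if [exists x : 'F_p, x ^+ 2 == a%:~R] then 1 else -1.

Definition quadratic_primes (a b c : int) : set nat :=
  [set p | prime p /\ exists x : nat, p%:Z = a * x%:Z ^+ 2 + b * x%:Z + c].

Definition discr (a b c : int) : int := b ^+ 2 - 4 * a * c.

(* The infinite product converges only conditionally: it is the limit of its
   partial products over the primes p < n. *)
Definition hl_constant (R : realType) (a b c : int) : R :=
  (gcdz 2 (a + b))%:~R / Num.sqrt a%:~R
  * \prod_(p <- primes `|a|%N | (2 < p)%N && (p%:Z %| b)%Z) (p%:R / (p%:R - 1))
  * lim ((\prod_(0 <= p < n | [&& prime p, (2 < p)%N & ~~ (p%:Z %| a)%Z])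
            (1 - (legendre (discr a b c) p)%:~R / (p%:R - 1) : R))
         @[n --> \oo]).

Definition hardy_littlewood (R : realType) : Prop :=
  forall a b c : int,
    0 < a -> gcdz (gcdz a b) c = 1 ->
    ~~ ((2 %| a + b)%Z && (2 %| c)%Z) ->
    ~ (exists d : int, discr a b c = d ^+ 2) ->
    (fun n : nat => (count_below (quadratic_primes a b c) n)%:R : R)
      ~_\oo (fun n : nat => hl_constant R a b c * (Num.sqrt n%:R / ln n%:R)).

(* F_p-points of the projective curve y^2 = x^3 + D x; None is the point at
   infinity. *)
Definition curve_points (D : int) (p : nat) : {set option ('F_p * 'F_p)} :=
  [set P : option ('F_p * 'F_p) | match P with
    | None => true
    | Some (x, y) => y ^+ 2 == x ^+ 3 + D%:~R * x
    end]%SET.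

Definition frob_trace (D : int) (p : nat) : int :=
  1 + p%:Z - #|curve_points D p|%:Z.

Definition Qset (m : int) : set nat :=
  [set p | prime p /\ exists x : int, p%:Z = m ^+ 2 + x ^+ 2].

(* [dens_is D m v] : the limit defining dens_D(2m) exists and equals v. *)
Definition dens_is (R : realType) (D m : int) (v : R) : Prop :=
  (count_below (Qset m `&`
     [set p | ~~ (p%:Z %| 2 * D)%Z /\ frob_trace D p = 2 * m]) N.+1)%:R
  / (count_below (Qset m) N.+1)%:R @[N --> \oo] --> v.

Definition tau_prime (l : nat) : nat :=
  (if l %% 4 == 3 then l else l - 2)%N.

Definition tau (n : nat) : nat := (\prod_(l <- primes n) tau_prime l)%N.

Definition count_mod8 (i : nat) (s : seq nat) : nat :=
  count (fun p => p %% 8 == i)%N s.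

(* Main.v *)
Require Import Defs.
From HB Require Import structures.
From mathcomp Require Import all_boot all_order all_algebra all_field.
From mathcomp Require Import all_classical all_reals all_analysis.
From mathcomp Require Import ring lra zify.
Set Implicit Arguments.
Unset Strict Implicit.
Unset Printing Implicit Defensive.
Import Order.TTheory GRing.Theory Num.Theory.
Import numFieldNormedType.Exports.
Local Open Scope ring_scope.

(** Let [p = a ^ 2 + x ^ 2] be a prime with [a] equal to 1 modulo 4 and [x] even,
    and put [pi = a + x i] in the Gaussian integers. Let [chi] be the quartic
    residue character modulo [pi] and [rho = chi ^ 2].

    The trace of the curve is [- \sum_v rho (v ^ 3 + D v)], which a substitution
    turns into a pair of conjugate Jacobi sums [\sum_v chi v * rho (1 - v)]. This
    Jacobi sum has norm [p], vanishes modulo [pi] and has a known residue modulo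
    [2 + 2 i], so it is [- chi (-1) * pi] ([jacobi_sumE]). Hence the trace is twice
    the real part of [gconj (chi D) * pi] ([frob_traceE]): it is [2 a] or [- 2 a]
    when [chi D] is 1 or -1, and [2 x] or [- 2 x] otherwise.

    The value [chi D] depends only on [x] modulo four times the product of the odd
    primes [q] dividing [D]. This is quartic reciprocity for a rational prime: in
    characteristic [q], the Frobenius map applied to the Gauss sum of [chi] gives
    [chi (qstar q) = ((a + x j) / (a - x j)) ^ n], where [j] is a square root of -1
    and [4 n] is the one of [q - 1] and [q + 1] that is divisible by 4
    ([gauss_sum_reciprocity], [torus_char_reciprocity]). When [x] runs through the
    classes modulo [q] with [a ^ 2 + x ^ 2] nonzero, the quotient runs through all
    [4 n]-th roots of unity but -1, which gives the power sums of the character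
    ([sum_torus_char]): the number [4 n - 1] of such classes is [tau_prime q], and
    the missing root -1 produces all the signs. The Chinese remainder theorem
    multiplies these sums ([sum_class_char]), and the proportion of classes with
    [chi D = 1] is the average over them of [(1 + chi + chi ^ 2 + chi ^ 3) / 4] at
    [D]; the terms of the theorem are these averages, [chi] and [chi ^ 3] having the
    same one.

    It remains to see that the primes [a ^ 2 + x ^ 2] are equidistributed among the
    classes of [x] modulo [M] for which [a ^ 2 + x ^ 2] is prime to [M]. Each class
    is the set of values of a quadratic polynomial of discriminant
    [- 4 (M a) ^ 2], and the Hardy-Littlewood constants of these polynomials
    coincide. They are nonzero because their Euler product differs by finitely many
    factors from that of [x ^ 2 + 1], and the latter polynomial takes the prime
    value 2, which a zero constant would forbid ([hl_constant_class],
    [density_of_classes]). *)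
(** * Gaussian integers *)

Record gaussint := Gauss { gre : int; gim : int }.

Definition pair_of_gauss z := (gre z, gim z).
Definition gauss_of_pair (u : int * int) := Gauss u.1 u.2.
Lemma pair_of_gaussK : cancel pair_of_gauss gauss_of_pair.
Proof. by case. Qed.

HB.instance Definition _ := Equality.copy gaussint (can_type pair_of_gaussK).
HB.instance Definition _ := Choice.copy gaussint (can_type pair_of_gaussK).

Definition gauss_add z w := Gauss (gre z + gre w) (gim z + gim w).
Definition gauss_opp z := Gauss (- gre z) (- gim z).
Definition gauss_mul z w :=
  Gauss (gre z * gre w - gim z * gim w) (gre z * gim w + gim z * gre w).

Lemma gauss_eq z w : gre z = gre w -> gim z = gim w -> z = w.
Proof. by case: z w => [a b] [c d] /= -> ->. Qed.

Lemma gauss_addA : associative gauss_add.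
Proof. by move=> x y z; apply: gauss_eq => /=; ring. Qed.
Lemma gauss_addC : commutative gauss_add.
Proof. by move=> x y; apply: gauss_eq => /=; ring. Qed.
Lemma gauss_add0 : left_id (Gauss 0 0) gauss_add.
Proof. by move=> x; apply: gauss_eq => /=; ring. Qed.
Lemma gauss_addN : left_inverse (Gauss 0 0) gauss_opp gauss_add.
Proof. by move=> x; apply: gauss_eq => /=; ring. Qed.
HB.instance Definition _ := GRing.isZmodule.Build gaussint
  gauss_addA gauss_addC gauss_add0 gauss_addN.

Lemma gauss_mulA : associative gauss_mul.
Proof. by move=> x y z; apply: gauss_eq => /=; ring. Qed.
Lemma gauss_mulC : commutative gauss_mul.
Proof. by move=> x y; apply: gauss_eq => /=; ring. Qed.
Lemma gauss_mul1 : left_id (Gauss 1 0) gauss_mul.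
Proof. by move=> x; apply: gauss_eq => /=; ring. Qed.
Lemma gauss_mulDl : left_distributive gauss_mul gauss_add.
Proof. by move=> x y z; apply: gauss_eq => /=; ring. Qed.
Lemma gauss_one_neq0 : Gauss 1 0 != Gauss 0 0.
Proof. by []. Qed.
HB.instance Definition _ := GRing.Zmodule_isComNzRing.Build gaussint
  gauss_mulA gauss_mulC gauss_mul1 gauss_mulDl gauss_one_neq0.

Lemma greD (z w : gaussint) : gre (z + w) = gre z + gre w. Proof. by []. Qed.
Lemma gimD (z w : gaussint) : gim (z + w) = gim z + gim w. Proof. by []. Qed.
Lemma greN (z : gaussint) : gre (- z) = - gre z. Proof. by []. Qed.
Lemma gimN (z : gaussint) : gim (- z) = - gim z. Proof. by []. Qed.
Lemma greM (z w : gaussint) : gre (z * w) = gre z * gre w - gim z * gim w.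
Proof. by []. Qed.
Lemma gimM (z w : gaussint) : gim (z * w) = gre z * gim w + gim z * gre w.
Proof. by []. Qed.
Lemma gre_nat n : gre n%:R = n%:Z.
Proof. by elim: n => // n IH; rewrite -natr1 greD IH /=; lia. Qed.
Lemma gim_nat n : gim n%:R = 0.
Proof. by elim: n => // n IH; rewrite -natr1 gimD IH. Qed.
Lemma gre_int (n : int) : gre n%:~R = n.
Proof. by case: n => n; rewrite ?NegzE ?rmorphN ?greN /= gre_nat. Qed.
Lemma gim_int (n : int) : gim n%:~R = 0.
Proof. by case: n => n; rewrite ?NegzE ?rmorphN ?gimN /= gim_nat ?oppr0. Qed.
Definition gaussE :=
  (greD, gimD, greN, gimN, greM, gimM, gre_nat, gim_nat, gre_int, gim_int).

Definition gi := Gauss 0 1.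
Lemma gauss_intr_inj : injective (intr : int -> gaussint).
Proof. by move=> m n /(congr1 gre); rewrite !gre_int. Qed.

Definition gconj z := Gauss (gre z) (- gim z).

Lemma gconj_is_zmod_morphism : zmod_morphism gconj.
Proof. by move=> x y; apply: gauss_eq => //=; ring. Qed.
Lemma gconj_is_monoid_morphism : monoid_morphism gconj.
Proof. by split=> // x y; apply: gauss_eq => //=; ring. Qed.
HB.instance Definition _ :=
  GRing.isZmodMorphism.Build gaussint gaussint gconj gconj_is_zmod_morphism.
HB.instance Definition _ :=
  GRing.isMonoidMorphism.Build gaussint gaussint gconj gconj_is_monoid_morphism.

Lemma gconjK : involutive gconj.
Proof. by move=> z; apply: gauss_eq => //=; ring. Qed.
Lemma gnormE z : z * gconj z = (gre z ^+ 2 + gim z ^+ 2)%:~R.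
Proof. by apply: gauss_eq; rewrite !gaussE /=; ring. Qed.
(** The norm reduces this to the integers. *)
Lemma gauss_mulf_eq0 (z w : gaussint) : z * w = 0 -> z != 0 -> w = 0.
Proof.
move=> zw0 z0; have : (z * w) * gconj (z * w) = 0 by rewrite zw0 mul0r.
rewrite rmorphM mulrACA !gnormE -rmorphM -[0]/(0%:~R) => /gauss_intr_inj /eqP.
rewrite mulf_eq0 => /orP[]/eqP norm0; last first.
  by apply: gauss_eq; rewrite /=; nia.
by case/eqP: z0; apply: gauss_eq; rewrite /=; nia.
Qed.

(** The evaluation [i |-> j] of Gaussian integers in a ring where [j] is a
    square root of [-1]; it lets one identity between Gaussian integers be read
    in characteristic 0, [p] and [q] alike. *)
Definition geval (K : comNzRingType) (j : K) (z : gaussint) : K :=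
  (gre z)%:~R + (gim z)%:~R * j.

Section Evaluation.
Variables (K : comNzRingType) (j : K).

Lemma gevalD (z w : gaussint) : geval j (z + w) = geval j z + geval j w.
Proof. by rewrite /geval !gaussE !rmorphD /=; ring. Qed.
Lemma geval0 : geval j 0 = 0. Proof. by rewrite /geval /= mul0r addr0. Qed.
Lemma geval1 : geval j 1 = 1.
Proof. by rewrite /geval /= mul0r addr0. Qed.
Lemma gevalN (z : gaussint) : geval j (- z) = - geval j z.
Proof. by rewrite /geval !gaussE !rmorphN /=; ring. Qed.
Lemma gevali : geval j gi = j.
Proof. by rewrite /geval /= add0r mul1r. Qed.
Lemma geval_conj z : geval j (gconj z) = geval (- j) z.
Proof. by rewrite /geval /= rmorphN /=; ring. Qed.
Lemma geval_sum (I : Type) (r : seq I) (P : pred I) (F : I -> gaussint) :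
  geval j (\sum_(k <- r | P k) F k) = \sum_(k <- r | P k) geval j (F k).
Proof. by apply: (big_morph _ gevalD geval0). Qed.

Hypothesis j2 : j * j = -1.

Lemma gevalM (z w : gaussint) : geval j (z * w) = geval j z * geval j w.
Proof.
rewrite /geval !gaussE !(rmorphD, rmorphN, rmorphM) /=.
move: (gre z)%:~R (gim z)%:~R (gre w)%:~R (gim w)%:~R => a b c d.
have -> : (a + b * j) * (c + d * j) = a * c + (a * d + b * c) * j + b * d * (j * j)
  by ring.
by rewrite j2; ring.
Qed.
Lemma gevalX (z : gaussint) n : geval j (z ^+ n) = geval j z ^+ n.
Proof. by elim: n => [|n IH]; rewrite ?geval1 // !exprS gevalM IH. Qed.
Lemma geval_int (n : int) : geval j n%:~R = n%:~R.
Proof. by rewrite /geval !gaussE mul0r addr0. Qed.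

Lemma geval_nat n : geval j n%:R = n%:R.
Proof. by rewrite /geval !gaussE mul0r addr0. Qed.

End Evaluation.

(** * Fourth roots of unity and quartic characters *)

(** The multiplicative section of [geval j] on the fourth roots of unity and
    [0]; other elements are sent to [0]. *)
Definition lift4 (F : fieldType) (j y : F) : gaussint :=
  if y == 1 then 1 else if y == j then gi
  else if y == -1 then -1 else if y == - j then - gi else 0.

Section Lift4.
Variables (F : fieldType) (j : F).
Hypotheses (j2 : j * j = -1) (two_neq0 : 2 != 0 :> F).

Lemma sqrtN1_distinct :
  [/\ j != 1, -1 != 1 :> F, -1 != j & [/\ - j != 1, - j != j & j != 0]].
Proof.
have N1 : -1 != 1 :> F.
  by apply: contra two_neq0 => /eqP h; rewrite -[2]/(1 + 1) -{1}h addNr.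
have j1 : j != 1.
  by apply: contra N1 => /eqP h; rewrite -j2 h mulr1.
have jN1 : -1 != j.
  by apply: contra N1 => /eqP h; rewrite -j2 -h mulrNN mulr1.
have j0 : j != 0.
  apply/eqP => h; move/eqP: j2; rewrite h mul0r eq_sym oppr_eq0.
  by rewrite oner_eq0.
split=> //; split=> //; first by rewrite eqr_oppLR eq_sym.
apply: contra two_neq0 => /eqP h.
have : 2 * j = 0 :> F by rewrite mulr_natl mulr2n -{1}h addNr.
by move/eqP; rewrite mulf_eq0 (negPf j0) orbF.
Qed.

Lemma lift4_0 : lift4 j 0 = 0.
Proof.
have [_ _ _ [_ _ j0]] := sqrtN1_distinct.
rewrite /lift4 ![0 == _]eq_sym oner_eq0 !oppr_eq0 oner_eq0 (negPf j0).
by [].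
Qed.
Lemma lift4_1 : lift4 j 1 = 1. Proof. by rewrite /lift4 eqxx. Qed.
Lemma lift4_j : lift4 j j = gi.
Proof. by have [/negPf j1 _ _ _] := sqrtN1_distinct; rewrite /lift4 j1 eqxx. Qed.
Lemma lift4_N1 : lift4 j (-1) = -1.
Proof.
have [_ /negPf n1 /negPf nj _] := sqrtN1_distinct.
by rewrite /lift4 n1 nj eqxx.
Qed.
Lemma lift4_Nj : lift4 j (- j) = - gi.
Proof.
have [/negPf j1 _ _ [/negPf n1 /negPf nj _]] := sqrtN1_distinct.
by rewrite /lift4 n1 nj eqr_opp j1 eqxx.
Qed.
Definition lift4E := (lift4_0, lift4_1, lift4_j, lift4_N1, lift4_Nj).

Lemma mu4P y : y ^+ 5 = y -> y \in [:: 0; 1; j; -1; - j].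
Proof.
move=> y5; have : y * (y - 1) * (y - j) * (y + 1) * (y + j) = 0.
  have -> : y * (y - 1) * (y - j) * (y + 1) * (y + j)
    = y ^+ 5 - y ^+ 3 - y ^+ 3 * (j * j) + y * (j * j) by ring.
  by rewrite j2 y5; ring.
move/eqP; rewrite !mulf_eq0 !subr_eq0 !addr_eq0 !inE.
by rewrite -!orbA.
Qed.

Lemma lift4M y z : y ^+ 5 = y -> z ^+ 5 = z ->
  lift4 j (y * z) = lift4 j y * lift4 j z.
Proof.
move=> /mu4P + /mu4P; rewrite !inE.
by move=> /or4P[||| /orP[]] /eqP-> /or4P[||| /orP[]] /eqP->;
  rewrite ?(mulrNN, mulNr, mulrN, j2, mul0r, mul1r, mulr0, mulr1, oppr0, opprK) !lift4E.
Qed.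

Lemma mu4X (y : F) n : y ^+ 5 = y -> (y ^+ n) ^+ 5 = y ^+ n.
Proof. by rewrite exprAC => ->. Qed.

Lemma lift4X y n : y ^+ 5 = y -> lift4 j (y ^+ n) = lift4 j y ^+ n.
Proof.
move=> y5; elim: n => [|n IH]; first exact: lift4_1.
by rewrite !exprS lift4M ?IH //; apply: mu4X.
Qed.

Lemma lift4K y : y ^+ 5 = y -> geval j (lift4 j y) = y.
Proof.
move=> /mu4P; rewrite !inE => /or4P[||| /orP[]] /eqP->;
by rewrite !lift4E ?gevalN ?gevali ?geval1 ?geval0.
Qed.

End Lift4.

(** The values of a quartic character: 0 and the fourth roots of unity. *)
Definition gmu4 (z : gaussint) := z \in [:: 0; 1; gi; -1; - gi].

Lemma lift4_mu4 (F : fieldType) (j y : F) : gmu4 (lift4 j y).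
Proof. by rewrite /lift4; do !case: ifP => // _. Qed.

Lemma gmu4M z w : gmu4 z -> gmu4 w -> gmu4 (z * w).
Proof.
by rewrite /gmu4 !inE => /or4P[||| /orP[]] /eqP-> /or4P[||| /orP[]] /eqP->.
Qed.

Lemma gmu4X z n : gmu4 z -> gmu4 (z ^+ n).
Proof. by move=> hz; elim: n => // n IH; rewrite exprS gmu4M. Qed.

Lemma gmu4_conj z : gmu4 z -> gconj z = z ^+ 3.
Proof. by rewrite /gmu4 !inE => /or4P[||| /orP[]] /eqP->. Qed.

Lemma gmu4_norm z : gmu4 z -> z != 0 -> z * gconj z = 1.
Proof. by rewrite /gmu4 !inE => /or4P[||| /orP[]] /eqP->. Qed.

Lemma gmu4_exp4 z : gmu4 z -> z ^+ 4 = (z != 0)%:R.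
Proof. by rewrite /gmu4 !inE => /or4P[||| /orP[]] /eqP->. Qed.

Lemma finField_generator (F : finFieldType) :
  exists w : F, #|F|.-1.-primitive_root w.
Proof.
pose rs := [seq x <- enum F | x != 0].
have F_gt1 : (1 < #|F|)%N := finRing_gt1 F.
have F_gt0 : (0 < #|F|.-1)%N by case: #|F| F_gt1 => [|[]].
have : has #|F|.-1.-primitive_root rs.
  apply: cyclic.has_prim_root => //.
  - apply/allP => x; rewrite mem_filter => /andP[x0 _].
    by apply/unity_rootP/(mulfI x0); rewrite -exprS mulr1 prednK ?expf_card // ltnW.
  - by rewrite filter_uniq // enum_uniq.
  rewrite size_filter; have := count_predC (pred1 0) (enum F).
  rewrite -cardE count_uniq_mem ?enum_uniq // mem_enum inE /= => h.
  by rewrite -{1}h.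
by case/hasP=> w _ hw; exists w.
Qed.

Definition quartic_setting (F : finFieldType) (m : nat) (j : F) :=
  #|F| = (4 * m).+1 /\ j * j = -1.

Section QuarticCharacter.
Variables (F : finFieldType) (m : nat) (j : F).
Hypothesis Q : quartic_setting m j.

Let cardF : #|F| = (4 * m).+1 := proj1 Q.
Let j2 : j * j = -1 := proj2 Q.

(** The sum of all elements is invariant under translation by 1. *)
Lemma finField_card_eq0 : #|F|%:R = 0 :> F.
Proof.
have : \sum_(v : F) v = \sum_(v : F) (v + 1).
  rewrite [LHS](reindex (fun v => v + 1)) //=.
  by exists (fun v => v - 1) => v _; rewrite ?subrK ?addrK.
by rewrite big_split /= sumr_const -[LHS]addr0 => /addrI <-.
Qed.

Lemma quartic_two_neq0 : 2 != 0 :> F.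
Proof.
apply/eqP => two0; have := finField_card_eq0.
rewrite cardF -natr1 -[(4 * m)%N]/((2 * 2) * m)%N !natrM two0 !mul0r add0r.
by move/eqP; rewrite oner_eq0.
Qed.
Let two_neq0 := quartic_two_neq0.

Definition qchar (v : F) := lift4 j (v ^+ m).
Definition qchar2 (v : F) := qchar v ^+ 2.

Lemma qm_gt0 : (0 < m)%N.
Proof. by have := finRing_gt1 F; rewrite cardF; case: m. Qed.

Lemma finField_exp4m (v : F) : v != 0 -> v ^+ (4 * m) = 1.
Proof.
move=> v0; apply: (mulfI v0); rewrite -exprS mulr1.
by rewrite -cardF; apply: expf_card.
Qed.

Lemma expm_mu4 (v : F) : (v ^+ m) ^+ 5 = v ^+ m.
Proof.
have [->|v0] := eqVneq v 0; first by rewrite expr0n gtn_eqF ?qm_gt0 // expr0n.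
by rewrite exprSr -exprM mulnC finField_exp4m // mul1r.
Qed.

Lemma qcharM (v w : F) : qchar (v * w) = qchar v * qchar w.
Proof. by rewrite /qchar exprMn (lift4M j2) //; apply: expm_mu4. Qed.
Lemma qchar0 : qchar 0 = 0.
Proof. by rewrite /qchar expr0n gtn_eqF ?qm_gt0 // lift4_0. Qed.
Lemma qchar1 : qchar 1 = 1.
Proof. by rewrite /qchar expr1n lift4_1. Qed.
Lemma qcharX (v : F) n : qchar (v ^+ n) = qchar v ^+ n.
Proof. by elim: n => [|n IH]; rewrite ?qchar1 // !exprS qcharM IH. Qed.
Lemma qchar_mu4 (v : F) : gmu4 (qchar v). Proof. exact: lift4_mu4. Qed.
Lemma qchar_eval (v : F) : geval j (qchar v) = v ^+ m.
Proof. by rewrite (lift4K j2) //; apply: expm_mu4. Qed.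
Lemma qchar_eq0 (v : F) : (qchar v == 0) = (v == 0).
Proof.
apply/eqP/eqP => [h|->]; last exact: qchar0.
have := qchar_eval v; rewrite h geval0 => /esym/eqP; rewrite expf_eq0.
by case/andP=> _ /eqP.
Qed.
Lemma qchar_norm (v : F) : v != 0 -> qchar v * gconj (qchar v) = 1.
Proof. by rewrite -qchar_eq0; apply/gmu4_norm/qchar_mu4. Qed.
Lemma qchar_conj (v : F) : gconj (qchar v) = qchar v ^+ 3.
Proof. exact/gmu4_conj/qchar_mu4. Qed.
Lemma qchar_conjV (v : F) : gconj (qchar v) = qchar v^-1.
Proof.
have [->|v0] := eqVneq v 0; first by rewrite invr0 qchar0 rmorph0.
rewrite -[LHS]mulr1 -qchar1 -(divff v0) qcharM mulrA [_ * qchar v]mulrC.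
by rewrite qchar_norm // mul1r.
Qed.
Lemma qchar2M (v w : F) : qchar2 (v * w) = qchar2 v * qchar2 w.
Proof. by rewrite /qchar2 qcharM exprMn. Qed.
Lemma qchar2_0 : qchar2 0 = 0. Proof. by rewrite /qchar2 qchar0 expr0n. Qed.
Lemma qchar2_1 : qchar2 1 = 1. Proof. by rewrite /qchar2 qchar1 expr1n. Qed.
Lemma qchar2_pm (v : F) : v != 0 -> qchar2 v = 1 \/ qchar2 v = -1.
Proof.
rewrite -qchar_eq0 /qchar2; have := qchar_mu4 v; rewrite /gmu4 !inE.
by move=> /or4P[||| /orP[]] /eqP->; [|left|right|left|right].
Qed.
Lemma qchar2_sq (v : F) : v != 0 -> qchar2 v ^+ 2 = 1.
Proof. by move/qchar2_pm => [->|->]. Qed.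
Lemma qcharN1_pm : qchar (-1) = 1 \/ qchar (-1) = -1.
Proof.
have : qchar (-1) ^+ 2 = 1 by rewrite -qcharX sqrrN expr1n qchar1.
by have := qchar_mu4 (-1); rewrite /gmu4 !inE
  => /or4P[||| /orP[]] /eqP-> // _; [left|right].
Qed.
Lemma qchar2N1 : qchar2 (-1) = 1.
Proof. by rewrite /qchar2 -qcharX sqrrN expr1n qchar1. Qed.
Lemma qchar2N (v : F) : qchar2 (- v) = qchar2 v.
Proof. by rewrite -mulN1r qchar2M qchar2N1 mul1r. Qed.
Lemma qcharN1_mul_conj : gconj (qchar (-1)) = qchar (-1).
Proof. by case: qcharN1_pm => ->. Qed.

Lemma exists_generator : exists w : F, (4 * m).-primitive_root w.
Proof. by have [w] := finField_generator F; rewrite cardF; exists w. Qed.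

Lemma exists_qchar2_N1 : exists w : F, [/\ (4 * m).-primitive_root w & qchar2 w = -1].
Proof.
have [w hw] := exists_generator; exists w; split=> //.
have w0 : w != 0.
  apply/eqP => w0; have := prim_expr_order hw; rewrite w0 expr0n.
  by rewrite muln_eq0 /= gtn_eqF ?qm_gt0 // => /eqP; rewrite eq_sym oner_eq0.
case: (qchar2_pm w0) => // h.
have : geval j (qchar2 w) = 1 by rewrite h geval1.
rewrite /qchar2 gevalX // qchar_eval // -exprM => /eqP.
rewrite -(prim_order_dvd hw) => /dvdn_leq.
have := qm_gt0; lia.
Qed.

(** Translating the summation variable by [w] multiplies the sum by [f w]. *)
Lemma mult_sum_eq0 (f : F -> gaussint) (w : F) : w != 0 ->
  (forall v, f (w * v) = f w * f v) -> f w != 1 -> \sum_v f v = 0.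
Proof.
move=> w0 fM fw; apply: (@gauss_mulf_eq0 (f w - 1)); last by rewrite subr_eq0.
rewrite mulrBl mul1r mulr_sumr; apply/eqP; rewrite subr_eq0; apply/eqP.
rewrite [RHS](reindex (fun v => w * v)) /=; last first.
  by exists (fun v => w^-1 * v) => v _; [rewrite mulKf|rewrite mulVKf].
by apply: eq_bigr => v _; rewrite fM.
Qed.

Lemma sum_qchar : \sum_v qchar v = 0.
Proof.
have [w [hw h]] := exists_qchar2_N1.
have w0 : w != 0 by apply/eqP => w0; move: h; rewrite w0 qchar2_0.
apply: (mult_sum_eq0 w0) => [v|]; first exact: qcharM.
by apply/eqP => h1; move: h; rewrite /qchar2 h1.
Qed.
Lemma sum_qchar_conj : \sum_v gconj (qchar v) = 0.
Proof. by rewrite -rmorph_sum /= sum_qchar rmorph0. Qed.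
Lemma sum_qchar2 : \sum_v qchar2 v = 0.
Proof.
have [w [hw h]] := exists_qchar2_N1.
have w0 : w != 0 by apply/eqP => w0; move: h; rewrite w0 qchar2_0.
apply: (mult_sum_eq0 w0) => [v|]; first exact: qchar2M.
by rewrite h.
Qed.

Lemma card_square_roots (t : F) :
  #|[pred y : F | y ^+ 2 == t]|%:R = 1 + qchar2 t :> gaussint.
Proof.
have [->|t0] := eqVneq t 0.
  rewrite qchar2_0 addr0 (eq_card (B := pred1 0)) ?card1 // => y.
  by rewrite !inE sqrf_eq0.
have [w [hw w1]] := exists_qchar2_N1.
have rootP y : y ^+ 2 = t -> #|[pred y : F | y ^+ 2 == t]| = 2%N /\ qchar2 t = 1.
  move=> yt; have y0 : y != 0.
    by apply: contra t0 => /eqP y0; rewrite -yt y0 expr0n.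
  split; last by rewrite -yt expr2 qchar2M -expr2 qchar2_sq.
  rewrite (eq_card (B := pred2 y (- y))); last first.
    by move=> z; rewrite !inE -yt eqf_sqr.
  rewrite card2 -addr_eq0 -mulr2n -mulr_natl mulf_eq0 (negPf two_neq0).
  by rewrite (negPf y0).
have : t \in [pred t | t ^+ (4 * m) == 1] by rewrite inE finField_exp4m.
move/eqP/(prim_rootP hw) => [[k klt] /= tE].
case kodd: (odd k); last first.
  have [] := rootP (w ^+ k./2).
    by rewrite -exprM muln2 tE -[in RHS](odd_double_half k) kodd.
  by move=> -> ->.
have qt : qchar2 t = -1.
  rewrite tE /qchar2 qcharX exprAC -/(qchar2 w) w1 -signr_odd kodd.
  by rewrite expr1.
rewrite qt addrN; case: (pickP [pred y : F | y ^+ 2 == t]) => [y /eqP /rootP[_]|h].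
  by rewrite qt.
by rewrite (eq_card0 h).
Qed.

End QuarticCharacter.

(** * The quartic Jacobi sum *)

Section JacobiSum.
Variables (F : finFieldType) (m : nat) (j : F).
Hypothesis Q : quartic_setting m j.

Local Notation chi := (qchar m j).
Local Notation rho := (qchar2 m j).

Definition jacobi_sum : gaussint := \sum_(v : F) chi v * rho (1 - v).

Lemma sum_qchar2_shift (a : F) : \sum_v rho (v - a) = 0.
Proof.
rewrite -[RHS](sum_qchar2 Q) [RHS](reindex (fun v => v - a)) //=.
by exists (fun v => v + a) => v _; rewrite ?subrK ?addrK.
Qed.

Lemma sum_qchar2_quad (a b : F) :
  \sum_v rho ((v - a) * (v - b)) = (a == b)%:R * #|F|%:R - 1.
Proof.
have [<-|ab] := eqVneq a b.
  rewrite (bigD1 a) //= subrr mul0r (qchar2_0 Q) // add0r mul1r.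
  rewrite (eq_bigr (fun _ => 1)); last first.
    move=> v va; rewrite (qchar2M Q) -expr2.
    by rewrite (qchar2_sq Q) // subr_eq0.
  by rewrite sumr_const (cardC1 a) (proj1 Q) /= -natr1 addrK.
rewrite mul0r sub0r.
have ba : b - a != 0 by rewrite subr_eq0 eq_sym.
(* Up to the square of v - a, the product is the quotient (v - b) / (v - a), which
   takes every value but 1. *)
have <- : \sum_(v | v != 1) rho v = -1.
  have := sum_qchar2 Q; rewrite (bigD1 1) //=.
  by rewrite qchar2_1 => /eqP; rewrite addrC addr_eq0 => /eqP.
rewrite (bigD1 a) //= subrr mul0r (qchar2_0 Q) // add0r.
rewrite [RHS](reindex_onto (fun v => (v - b) / (v - a))
                           (fun w => (b - a * w) / (1 - w))) /=; last first.
  move=> w w1; have w1' : 1 - w != 0 by rewrite subr_eq0 eq_sym.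
  have -> : (b - a * w) / (1 - w) - b = (b - a) * w / (1 - w) by field.
  have -> : (b - a * w) / (1 - w) - a = (b - a) / (1 - w) by field.
  by field; rewrite ba w1'.
apply: eq_big => v.
  have [->|va] := eqVneq v a.
    rewrite subrr invr0 mulr0 eq_sym oner_eq0 /= mulr0 !subr0 divr1.
    by rewrite eq_sym (negPf ab).
  have va' : v - a != 0 by rewrite subr_eq0.
  have e : 1 - (v - b) / (v - a) = (b - a) / (v - a) by field.
  have h1 : 1 - (v - b) / (v - a) != 0 by rewrite e mulf_neq0 // invr_eq0.
  rewrite eq_sym -subr_eq0 h1 /= e; apply/esym/eqP; field.
  by rewrite ba va'.
move=> va; have va' : v - a != 0 by rewrite subr_eq0.
have -> : (v - a) * (v - b) = ((v - a) * (v - a)) * ((v - b) / (v - a)) by field.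
rewrite (qchar2M Q) [X in X * _](qchar2M Q).
by rewrite -expr2 (qchar2_sq Q) // mul1r.
Qed.

(** Substituting [u = w v] in the double sum for [J * gconj J] leaves, for each
    [w], the sum of [rho] over the values of a quadratic polynomial. *)
Lemma jacobi_sum_norm : jacobi_sum * gconj jacobi_sum = #|F|%:R.
Proof.
rewrite mulrC {1}/jacobi_sum rmorph_sum /= mulr_suml.
have rho_conj v : gconj (rho v) = rho v.
  have [->|v0] := eqVneq v 0; first by rewrite (qchar2_0 Q) // rmorph0.
  by case: (qchar2_pm Q v0) => ->.
transitivity (\sum_(v : F | v != 0) \sum_w chi w * rho ((v^-1 - w) * (v^-1 - 1))).
  rewrite (bigID (fun v => v != 0)) /= addrC big1 ?add0r => [|v]; last first.
    by rewrite negbK => /eqP->; rewrite (qchar0 Q) mul0r rmorph0 mul0r.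
  apply: eq_bigr => v v0.
  rewrite /jacobi_sum (reindex (fun w => w * v)) /=; last first.
    by exists (fun w => w / v) => w _; rewrite ?mulfK ?mulfVK.
  rewrite mulr_sumr; apply: eq_bigr => w _.
  have -> : rho ((v^-1 - w) * (v^-1 - 1)) = rho (1 - v) * rho (1 - w * v).
    rewrite -[LHS]mul1r -(qchar2_sq Q v0) expr2 -!(qchar2M Q); congr (rho _).
    by field.
  rewrite (qcharM Q) rmorphM /= rho_conj -[RHS]mul1r -(qchar_norm Q v0).
  by ring.
rewrite exchange_big /=.
transitivity (\sum_w chi w * ((w == 1)%:R * #|F|%:R - 1 - rho w)).
  apply: eq_bigr => w _; rewrite -mulr_sumr; congr (_ * _).
  rewrite -sum_qchar2_quad [in RHS](bigD1 0) //= !sub0r mulrN1 opprK addrAC subrr add0r.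
  rewrite (reindex_onto (fun v => v^-1) (fun v => v^-1)) /=; last first.
    by move=> v _; rewrite invrK.
  by apply: eq_big => v; rewrite ?invr_eq0 ?invrK ?eqxx ?andbT.
under eq_bigr do rewrite !mulrBr mulr1 mulrA.
rewrite !sumrB (sum_qchar Q) subr0 -mulr_suml.
rewrite (bigD1 1) //= eqxx mulr1 qchar1 big1 ?addr0; last first.
  by move=> w /negPf->; rewrite mulr0.
rewrite mul1r (_ : \sum_w _ = 0) ?subr0 //.
rewrite -[RHS](sum_qchar_conj Q); apply: eq_bigr => w _.
by rewrite qchar_conj -exprS.
Qed.

(** Multiplying the summation variable by a generator [w] multiplies the sum by
    [w ^+ k], which is not 1. *)
Lemma power_sum_eq0 k : (k < 4 * m)%N -> \sum_(v : F) v ^+ k = 0.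
Proof.
case: k => [_|k klt]; first by rewrite sumr_const finField_card_eq0.
have [w hw] := exists_generator Q.
have w0 : w != 0.
  apply/eqP => w0; have := prim_expr_order hw; rewrite w0 expr0n gtn_eqF //.
    by move/eqP; rewrite eq_sym oner_eq0.
  by apply: leq_trans klt.
have w1 : w ^+ k.+1 - 1 != 0.
  rewrite subr_eq0 -(prim_order_dvd hw); apply/negP => /(dvdn_leq (ltn0Sn k)).
  by rewrite leqNgt klt.
apply: (mulfI w1); rewrite mulr0 mulrBl mul1r mulr_sumr.
rewrite [X in _ - X](reindex (fun v => w * v)) /=; last first.
  by exists (fun v => w^-1 * v) => v _; [rewrite mulKf|rewrite mulVKf].
by apply/eqP; rewrite subr_eq0; apply/eqP/eq_bigr => v _; rewrite exprMn.
Qed.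

(** In [F] the Jacobi sum becomes a sum of values of a polynomial of degree
    [3m], less than [#|F| - 1]. *)
Lemma jacobi_sum_eval : geval j jacobi_sum = 0.
Proof.
rewrite geval_sum.
transitivity (\sum_(v : F) v ^+ m * (1 - v) ^+ (2 * m)).
  apply: eq_bigr => v _; rewrite (gevalM (proj2 Q)) (gevalX (proj2 Q)) !(qchar_eval Q).
  by rewrite -exprM [(m * 2)%N]mulnC.
transitivity (\sum_(i < (2 * m).+1)
  (-1) ^+ i *+ 'C(2 * m, i) * \sum_(v : F) v ^+ (m + i)).
  under [RHS]eq_bigr do rewrite mulr_sumr.
  rewrite exchange_big; apply: eq_bigr => v _; rewrite exprBn mulr_sumr.
  by apply: eq_bigr => i _; rewrite expr1n mulr1 exprD mulrnAl mulrnAr mulrCA.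
rewrite big1 // => i _; rewrite power_sum_eq0 ?mulr0 //.
have := ltn_ord i; have := qm_gt0 Q; lia.
Qed.

(** Since [chi] and [rho] have sum 0, the sum over [v] of
    [(chi v - 1) (rho (1 - v) - 1)] is [J + #|F|], and each of its terms is a
    multiple of [2 + 2i]. *)
Lemma jacobi_sum_mod : exists z, jacobi_sum + #|F|%:R = Gauss 2 2 * z.
Proof.
have -> : jacobi_sum + #|F|%:R = \sum_(v : F) (chi v - 1) * (rho (1 - v) - 1).
  under eq_bigr do rewrite mulrBr mulrBl mulr1 mul1r opprB.
  rewrite big_split /= sumrB -/jacobi_sum sumrB sumr_const.
  rewrite (sum_qchar Q) subr0.
  under [X in _ - X]eq_bigr do rewrite -opprB (qchar2N Q).
  by rewrite sum_qchar2_shift; ring.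
apply: (big_rec (fun s => exists z, s = Gauss 2 2 * z)).
  by exists 0; rewrite mulr0.
move=> v s _ [z ->].
suff [z' ->] : exists z', (chi v - 1) * (rho (1 - v) - 1) = Gauss 2 2 * z'.
  by exists (z' + z); rewrite mulrDr.
have [->|v0] := eqVneq v 0.
  by exists 0; rewrite subr0 qchar2_1 subrr !mulr0.
have [->|v1] := eqVneq v 1.
  by exists 0; rewrite qchar1 subrr mul0r mulr0.
have := qchar_mu4 m j v; have := qchar_eq0 Q v.
have v1' : 1 - v != 0 by rewrite subr_eq0 eq_sym.
case: (qchar2_pm Q v1') => ->.
  by exists 0; rewrite subrr !mulr0.
rewrite (negPf v0) /gmu4 !inE => h /or4P[||| /orP[]] /eqP hv; move: h; rewrite hv //.
- by exists 0.
- by exists (- gi).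
- by exists (Gauss 1 (-1)).
- by exists 1.
Qed.

(** Grouping the terms by [u = v ^+ 2], which has [1 + rho u] square roots, turns
    this sum into a pair of conjugate Jacobi sums. *)
Lemma cubic_sum_jacobi (d : F) : d != 0 ->
  \sum_(v : F) rho (v ^+ 3 + d * v)
    = gconj (chi d) * chi (-1) * jacobi_sum
      + gconj (gconj (chi d) * chi (-1) * jacobi_sum).
Proof.
move=> d0; transitivity (\sum_(u : F) (1 + rho u) * (chi u * rho (u + d))).
  under [RHS]eq_bigr do
    rewrite -(card_square_roots Q) -sum1_card natr_sum mulr_suml.
  rewrite (exchange_big_dep xpredT) //=; apply: eq_bigr => v _.
  rewrite (big_pred1 (v ^+ 2)) => [|u]; last by rewrite inE eq_sym.
  by rewrite mul1r (qcharX Q) -/(rho v) -(qchar2M Q); congr (rho _); ring.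
have TE : \sum_(u : F) chi u * rho (u + d) = gconj (chi d) * chi (-1) * jacobi_sum.
  rewrite (reindex (fun u => - d * u)) /=; last first.
    by exists (fun u => (- d)^-1 * u) => u _; rewrite ?mulKf ?mulVKf ?oppr_eq0.
  rewrite /jacobi_sum mulr_sumr; apply: eq_bigr => u _.
  rewrite (_ : - d * u + d = d * (1 - u)); last by ring.
  rewrite -(mulN1r d) !(qcharM Q) (qchar2M Q) qchar_conj /qchar2.
  by ring.
rewrite -TE rmorph_sum -big_split /=; apply: eq_bigr => u _.
rewrite mulrDl mul1r rmorphM /= qchar_conj; congr (_ + _).
rewrite (_ : gconj (rho (u + d)) = rho (u + d)); first by rewrite /qchar2; ring.
have [->|v0] := eqVneq (u + d) 0; first by rewrite (qchar2_0 Q) rmorph0.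
by case: (qchar2_pm Q v0) => ->.
Qed.

End JacobiSum.

(** * Primes that are sums of two squares *)

(** From [p ^ 2 = (A x - B a) ^ 2 + (A a + B x) ^ 2] with [p] dividing the first
    term, either term may be the one that vanishes; parity selects the first. *)
Lemma two_squares_unique (p : nat) (A B a x : int) : prime p -> odd p ->
  p%:Z = A ^+ 2 + B ^+ 2 -> p%:Z = a ^+ 2 + x ^+ 2 ->
  (p%:Z %| A * x - B * a)%Z -> (2 %| B)%Z -> (2 %| x)%Z ->
  (A = a /\ B = x) \/ (A = - a /\ B = - x).
Proof.
move=> p_pr p_odd pAB pax /dvdzP[k uE] /dvdzP[B' BE] /dvdzP[x' xE].
have p_gt1 := prime_gt1 p_pr.
have norm : (A * x - B * a) ^+ 2 + (A * a + B * x) ^+ 2 = p%:Z ^+ 2.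
  by rewrite [RHS]expr2 {1}pAB pax; ring.
have k0 : k = 0.
  have [P PE] : exists P : int, p%:Z = 1 + 2 * P.
    by exists (p./2)%:Z; move: p_odd; clear; lia.
  have ev : exists t, k = 2 * t.
    exists (A * x' - B' * a - k * P); move: uE; rewrite BE xE PE => uE.
    by transitivity (k * (1 + 2 * P) - 2 * k * P); [ring | rewrite -uE; ring].
  case: ev => t tE; apply: contraTeq isT => k_neq0.
  have t2 : 1 <= t ^+ 2.
    rewrite -gtz0_ge1 exprn_even_gt0 //=.
    by apply: contraNneq k_neq0 => t0; rewrite tE t0 mulr0.
  have w2 := sqr_ge0 (A * a + B * x).
  have p2 : 1 <= p%:Z ^+ 2 by rewrite expr_ge1 //; lia.
  have : 4 * (t ^+ 2 * p%:Z ^+ 2) <= p%:Z ^+ 2.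
    rewrite -{2}norm uE tE -subr_ge0.
    by rewrite (_ : _ - _ = (A * a + B * x) ^+ 2) //; ring.
  have : p%:Z ^+ 2 <= t ^+ 2 * p%:Z ^+ 2 by rewrite ler_peMl //; lia.
  by move: p2; move: (p%:Z ^+ 2) (t ^+ 2 * p%:Z ^+ 2) => u v; clear; lia.
move: uE norm; rewrite k0 mul0r => u0; rewrite u0 expr0n add0r => /eqP.
have A_eq : A * p%:Z = a * (A * a + B * x) + x * (A * x - B * a).
  by rewrite pax; ring.
have B_eq : B * p%:Z = x * (A * a + B * x) - a * (A * x - B * a).
  by rewrite pax; ring.
move: A_eq B_eq; rewrite u0 !mulr0 addr0 subr0 eqf_sqr => + + /orP[]/eqP wE.
  rewrite wE => hA hB; left; split; apply: (@mulIf _ p%:Z) => //; lia.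
rewrite wE => hA hB; right; split; apply: (@mulIf _ p%:Z) => //; lia.
Qed.

(** Here [z1 + z2 i] witnesses that [s (1 + 4 b + 2 k i)] is [- (4 M + 1)] modulo
    [2 + 2 i]. *)
Lemma primary_sign (M : nat) (b k s z1 z2 : int) :
    M%:Z = 2 * b + 4 * b ^+ 2 + k ^+ 2 -> s = 1 \/ s = -1 ->
    s * (1 + 4 * b) + (4 * M%:Z + 1) = 2 * z1 - 2 * z2 ->
    s * (2 * k) = 2 * z2 + 2 * z1 ->
  s = - (-1) ^+ M.
Proof.
move=> ME s1 zre zim.
have oddM : odd M = ~~ (2 %| k)%Z.
  have [t kE] : exists t, k = 2 * t + (~~ (2 %| k)%Z)%:Z by exists (k %/ 2)%Z; lia.
  have : M%:Z = 2 * (b + 2 * b ^+ 2 + 2 * t ^+ 2 + 2 * t * (~~ (2 %| k)%Z)%:Z)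
                 + (~~ (2 %| k)%Z)%:Z.
    by rewrite ME {1}kE; case: (~~ _) => /=; ring.
  by move: (_ + _ + _ + _); case: (~~ _) => u; clear; lia.
rewrite -signr_odd oddM; move: zre zim; clear ME oddM.
by case: s1 => ->; case: (boolP (2 %| k)%Z) => /=; lia.
Qed.

Lemma qcharN1 (F : finFieldType) m (j : F) : quartic_setting m j ->
  qchar m j (-1) = (-1) ^+ m.
Proof.
move=> Q; rewrite /qchar -(signr_odd F) -(signr_odd gaussint).
have [_ j2] := Q; have two := quartic_two_neq0 Q.
by case: (odd m); [rewrite !expr1 lift4_N1 | rewrite !expr0 lift4_1].
Qed.

Section TwoSquaresPrime.
Variables (p : nat) (a x : int).
Hypotheses (p_pr : prime p) (pE : p%:Z = a ^+ 2 + x ^+ 2).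
Hypotheses (a1 : (a = 1 %[mod 4])%Z) (x_even : (2 %| x)%Z).

(** The square root of -1 at which [a + x i] vanishes: evaluating Gaussian integers
    there is reduction modulo the prime [a + x i]. *)
Definition sqrtN1 : 'F_p := - a%:~R / x%:~R.

Lemma a1_decomp : exists b, a = 1 + 4 * b.
Proof. by exists (a %/ 4)%Z; lia. Qed.

Lemma x_even_decomp : exists k, x = 2 * k.
Proof. by case/dvdzP: x_even => k ->; exists k; rewrite mulrC. Qed.

Lemma two_squares_mod4 : exists b k : int,
  [/\ a = 1 + 4 * b, x = 2 * k & (p %/ 4)%N%:Z = 2 * b + 4 * b ^+ 2 + k ^+ 2]
  /\ p = (4 * (p %/ 4)).+1.
Proof.
have [b aE] := a1_decomp; have [k xE] := x_even_decomp.
exists b, k; have pE' : p%:Z = 1 + 4 * (2 * b + 4 * b ^+ 2 + k ^+ 2).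
  by rewrite pE aE xE; ring.
by split; first split=> //; lia.
Qed.

Lemma two_squares_odd : odd p.
Proof. by have [b [k [_ ->]]] := two_squares_mod4; lia. Qed.

Lemma intr_Fp_eq0 (n : int) : (n%:~R == 0 :> 'F_p) = (p%:Z %| n)%Z.
Proof. by rewrite -(dvdz_pcharf (pchar_Fp p_pr)). Qed.

Lemma ndvd_of_sum_squares (u v : int) : p%:Z = u ^+ 2 + v ^+ 2 ->
  ~~ (p%:Z %| u)%Z.
Proof.
move=> uv; apply/negP => /dvdzP[k kE].
have p_gt1 := prime_gt1 p_pr.
have [k0|k0] := eqVneq k 0; last first.
  have : p%:Z ^+ 2 <= p%:Z.
    rewrite {2}uv kE exprMn -[leLHS]addr0 lerD ?sqr_ge0 // ler_peMl ?sqr_ge0 //.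
    by rewrite -gtz0_ge1 exprn_even_gt0.
  by rewrite expr2 ger_pMl; lia.
move: uv; rewrite kE k0 mul0r expr0n add0r => pv.
have pv' : p = (`|v| * `|v|)%N by rewrite -abszM -expr2 -pv.
have /primeP[_ /(_ `|v|%N)] := p_pr; rewrite {1 2}pv' dvdn_mulr // => /(_ isT).
move: p_gt1; rewrite pv'; move: `|v|%N => n; clear.
by case: n => [|[|n]] // _ /orP[]/eqP; lia.
Qed.

Lemma x_Fp_neq0 : x%:~R != 0 :> 'F_p.
Proof.
by rewrite intr_Fp_eq0; apply: (@ndvd_of_sum_squares _ a); rewrite addrC.
Qed.

Lemma sqrtN1_root : a%:~R + x%:~R * sqrtN1 = 0.
Proof. by rewrite /sqrtN1 mulrC mulfVK ?subrr // x_Fp_neq0. Qed.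

Lemma sqrtN1_sq : sqrtN1 * sqrtN1 = -1.
Proof.
have x0 := x_Fp_neq0.
have : (a ^+ 2 + x ^+ 2)%:~R = 0 :> 'F_p.
  by rewrite -pE; apply/eqP; rewrite intr_Fp_eq0.
rewrite rmorphD !rmorphXn /= => /eqP; rewrite addr_eq0 => /eqP a2.
rewrite /sqrtN1 mulrACA mulrNN -expr2 a2; field; exact: x0.
Qed.

Lemma two_squares_quartic : quartic_setting (p %/ 4) sqrtN1.
Proof.
split; last exact: sqrtN1_sq.
by have [b [k [_ pE4]]] := two_squares_mod4; rewrite card_Fp.
Qed.
Let Q := two_squares_quartic.

Local Notation chi := (qchar (p %/ 4) sqrtN1).
Local Notation rho := (qchar2 (p %/ 4) sqrtN1).
Local Notation J := (jacobi_sum (p %/ 4) sqrtN1).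

(** The norm and the vanishing of [J] at [sqrtN1] determine [J] up to sign, and
    its residue modulo [2 + 2i] fixes the sign. *)
Lemma jacobi_sumE : J = - chi (-1) * Gauss a x.
Proof.
have normJ : p%:Z = gre J ^+ 2 + gim J ^+ 2.
  apply: gauss_intr_inj; rewrite -gnormE (jacobi_sum_norm Q) card_Fp //.
have evJ := jacobi_sum_eval Q; rewrite /geval in evJ.
have dvdJ : (p%:Z %| gre J * x - gim J * a)%Z.
  rewrite -intr_Fp_eq0 rmorphB !rmorphM /=.
  have := sqrtN1_root => /eqP; rewrite addr_eq0 => /eqP ->.
  by move/eqP: evJ; rewrite addr_eq0 => /eqP ->; apply/eqP; ring.
have [z zE] := jacobi_sum_mod Q.
have [zre zim] : gre J + p%:Z = 2 * gre z - 2 * gim z /\ gim J = 2 * gim z + 2 * gre z.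
  have := congr1 gim zE; have := congr1 gre zE.
  by rewrite !gaussE card_Fp // addr0 => -> ->; split=> //=; ring.
have evB : (2 %| gim J)%Z by rewrite zim -mulrDr dvdz_mulr.
have [b [k [[aE xE mE] p4]]] := two_squares_mod4.
suff [s [JA JB s1]] : exists s : int, [/\ gre J = s * a, gim J = s * x & s = 1 \/ s = -1].
  have -> : Gauss a x = Gauss (1 + 4 * b) (2 * k) by rewrite aE xE.
  rewrite (qcharN1 Q) (_ : - (-1) ^+ _ = s%:~R); last first.
    rewrite (@primary_sign (p %/ 4) b k s (gre z) (gim z)) //.
    - by rewrite rmorphN rmorphXn.
    - have pZ : p%:Z = 4 * (p %/ 4)%N%:Z + 1 by move: p4; clear; lia.
      by rewrite -aE -JA -pZ.
    - by rewrite -xE -JB.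
  by apply: gauss_eq; rewrite !gaussE /= ?JA ?JB ?aE ?xE; ring.
have [] := two_squares_unique p_pr two_squares_odd normJ pE dvdJ evB x_even.
  by case=> -> ->; exists 1; rewrite !mul1r; split=> //; left.
by case=> -> ->; exists (-1); rewrite !mulN1r; split=> //; right.
Qed.

Lemma card_curve_points D :
  #|curve_points D p|%:R
    = 1 + \sum_(v : 'F_p) (1 + rho (v ^+ 3 + D%:~R * v)) :> gaussint.
Proof.
pose B := [set u : 'F_p * 'F_p | u.2 ^+ 2 == u.1 ^+ 3 + D%:~R * u.1]%SET.
have -> : curve_points D p = (None |: Some @: B)%SET.
  apply/setP => -[[u v]|]; rewrite !inE //=.
  apply/idP/idP => [h|/imsetP[[u' v']]]; last by rewrite inE /= => h [-> ->].
  by apply: imset_f; rewrite inE.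
rewrite cardsU1 card_imset; last by move=> u v [].
rewrite (_ : None \notin _) ?natrD; last by apply/imsetP => -[].
congr (_ + _); rewrite -sum1_card natr_sum.
rewrite (eq_bigl (fun u => true && (u.2 ^+ 2 == u.1 ^+ 3 + D%:~R * u.1))); last first.
  by move=> u; rewrite inE.
rewrite -(pair_big_dep xpredT (fun u v => v ^+ 2 == u ^+ 3 + D%:~R * u)
                       (fun _ _ => 1)) /=.
apply: eq_bigr => u _; rewrite -(card_square_roots Q) -sum1_card natr_sum.
by apply: eq_bigl => v; rewrite inE.
Qed.

(** The two factors [chi (-1)], one from the substitution and one from the Jacobi
    sum, cancel. *)
Lemma frob_traceE D : ~~ (p%:Z %| D)%Z ->
  (frob_trace D p)%:~R
    = gconj (chi D%:~R) * Gauss a x + chi D%:~R * gconj (Gauss a x) :> gaussint.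
Proof.
rewrite -intr_Fp_eq0 => d0.
have -> : (frob_trace D p)%:~R
    = - \sum_(v : 'F_p) rho (v ^+ 3 + D%:~R * v) :> gaussint.
  rewrite /frob_trace rmorphB rmorphD /= -[#|_|%:~R]/(#|_|%:R) card_curve_points.
  rewrite big_split /= sumr_const card_Fp // -[p%:~R]/(p%:R).
  by move: (\sum_v _) => S; ring.
rewrite (cubic_sum_jacobi Q d0) jacobi_sumE.
have : chi (-1) * chi (-1) = 1 by rewrite -expr2 -/(rho _) (qchar2N1 Q).
have := qcharN1_mul_conj Q.
move: (chi (-1)) (chi D%:~R) (Gauss a x) => c d g.
rewrite !rmorphM rmorphN /= gconjK => -> c2.
transitivity ((c * c) * (gconj d * g + d * gconj g)); first by ring.
by rewrite c2 mul1r.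
Qed.

(** The two other values of [chi] give the traces [2 x] and [- 2 x], which differ
    from [2 a] and [- 2 a] because [a] is odd and [x] even. *)
Lemma frob_trace_eq D : ~~ (p%:Z %| D)%Z ->
  (frob_trace D p = 2 * a <-> chi D%:~R = 1) /\
  (frob_trace D p = 2 * - a <-> chi D%:~R = -1).
Proof.
move=> pD; have := congr1 gre (frob_traceE pD); rewrite gre_int => ->.
have [b [k [[aE xE _] _]]] := two_squares_mod4.
have : chi D%:~R != 0 by rewrite (qchar_eq0 Q) intr_Fp_eq0.
have := qchar_mu4 (p %/ 4) sqrtN1 D%:~R.
rewrite /gmu4 !inE => /or4P[||| /orP[]] /eqP -> // _;
  by rewrite !gaussE /=; split; split=> //; lia.
Qed.

End TwoSquaresPrime.

(** * Gauss sums in characteristic q *)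

Section GaussSums.
Variables (F : finFieldType) (m : nat) (j : F) (L : fieldType) (i : L).
Variable psi : F -> L.
Hypotheses (Q : quartic_setting m j) (i2 : i * i = -1).
Hypothesis psiD : forall u v, psi (u + v) = psi u * psi v.
Hypothesis psi_sum : \sum_v psi v = 0.
Hypothesis psi0 : psi 0 = 1.
Hypothesis F_neq0 : #|F|%:R != 0 :> L.

Local Notation chi := (qchar m j).
Local Notation rho := (qchar2 m j).
Local Notation J := (jacobi_sum m j).
Local Notation ev := (geval i).

Definition gauss_sum (f : F -> gaussint) := \sum_v ev (f v) * psi v.

(** The terms of the product are grouped by the sum [t] of the two variables; for
    [t] nonzero, scaling by [t] produces a Jacobi sum. *)
Lemma gauss_sumM f g :
    (forall u v, f (u * v) = f u * f v) -> (forall u v, g (u * v) = g u * g v) ->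
  gauss_sum f * gauss_sum g = ev (\sum_u f u * g (- u))
    + ev (\sum_u f u * g (1 - u)) * \sum_(t | t != 0) ev (f t * g t) * psi t.
Proof.
move=> fM gM.
transitivity (\sum_t \sum_u ev (f u * g (t - u)) * psi t).
  rewrite /gauss_sum mulr_suml exchange_big; apply: eq_bigr => u _.
  rewrite mulr_sumr [RHS](reindex (fun t => t + u)) /=; last first.
    by exists (fun t => t - u) => t _; rewrite ?addrK ?subrK.
  by apply: eq_bigr => v _; rewrite addrK gevalM // psiD; ring.
rewrite (bigD1 0) //= psi0 geval_sum; congr (_ + _).
  by apply: eq_bigr => u _; rewrite sub0r mulr1.
rewrite mulr_sumr; apply: eq_bigr => t t0.
rewrite -mulr_suml mulrA; congr (_ * _); rewrite -geval_sum -gevalM //; congr ev.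
rewrite (reindex (fun u => t * u)) /=; last first.
  by exists (fun u => t^-1 * u) => u _; [rewrite mulKf|rewrite mulVKf].
rewrite mulr_suml; apply: eq_bigr => u _.
rewrite (_ : t - t * u = t * (1 - u)); last by ring.
by rewrite fM gM; ring.
Qed.

Lemma sum_psi_neq0 : \sum_(t | t != 0) psi t = -1.
Proof.
by have := psi_sum; rewrite (bigD1 0) //= psi0 addrC => /eqP; rewrite addr_eq0 => /eqP.
Qed.

Lemma gauss_sum_rho : gauss_sum rho ^+ 2 = #|F|%:R.
Proof.
rewrite expr2 gauss_sumM; try by move=> u v; apply: (qchar2M Q).
have rho2 t : t != 0 -> rho t * rho t = 1 by rewrite -expr2; apply: qchar2_sq.
have -> : \sum_u rho u * rho (- u) = #|F|%:R - 1.
  under eq_bigr do rewrite (qchar2N Q).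
  rewrite (bigD1 0) //= (qchar2_0 Q) mul0r add0r (eq_bigr (fun _ => 1)) //.
  by rewrite sumr_const (cardC1 0) (proj1 Q) /= -natr1 addrK.
have -> : \sum_u rho u * rho (1 - u) = -1.
  transitivity (\sum_u rho ((u - 0) * (u - 1))).
    by apply: eq_bigr => u _; rewrite subr0 -opprB (qchar2N Q) -(qchar2M Q).
  by rewrite (sum_qchar2_quad Q) eq_sym oner_eq0 mul0r sub0r.
rewrite (eq_bigr psi) => [|t t0]; last by rewrite rho2 // geval1 mul1r.
by rewrite sum_psi_neq0 gevalD !gevalN geval1 geval_nat; ring.
Qed.

Lemma gauss_sum_chi_rho :
  gauss_sum chi * gauss_sum rho = ev J * gauss_sum (fun v => gconj (chi v)).
Proof.
rewrite gauss_sumM; first last.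
- by move=> u v; apply: (qchar2M Q).
- by move=> u v; apply: (qcharM Q).
have chi3 v : chi v * rho v = gconj (chi v) by rewrite qchar_conj /qchar2 exprS.
rewrite (eq_bigr (fun u => gconj (chi u))) => [|u _]; last first.
  by rewrite (qchar2N Q) chi3.
rewrite (sum_qchar_conj Q) geval0 add0r; congr (_ * _).
rewrite /gauss_sum [RHS](bigD1 0) //= (qchar0 Q) rmorph0 geval0 mul0r add0r.
by apply: eq_bigr => u _; rewrite chi3.
Qed.

Lemma gauss_sum_chi_conj :
  gauss_sum chi * gauss_sum (fun v => gconj (chi v)) = ev (chi (-1)) * #|F|%:R.
Proof.
have cM u v : gconj (chi (u * v)) = gconj (chi u) * gconj (chi v).
  by rewrite (qcharM Q) rmorphM.
rewrite gauss_sumM //; last by move=> u v; apply: (qcharM Q).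
have -> : \sum_u chi u * gconj (chi (- u)) = chi (-1) * (#|F|%:R - 1).
  rewrite (bigD1 0) //= (qchar0 Q) mul0r add0r (eq_bigr (fun _ => chi (-1))).
    by rewrite sumr_const (cardC1 0) (proj1 Q) /= -natr1 addrK mulr_natr.
  move=> u u0; rewrite -(mulN1r u) cM (qcharN1_mul_conj Q) mulrCA.
  by rewrite (qchar_norm Q) // mulr1.
have -> : \sum_u chi u * gconj (chi (1 - u)) = - chi (-1).
  transitivity (\sum_(w | w != -1) chi w); last first.
    have := sum_qchar Q; rewrite (bigD1 (-1)) //= addrC => /eqP.
    by rewrite addr_eq0 => /eqP.
  rewrite (bigD1 1) //= subrr (qchar0 Q) rmorph0 mulr0 add0r.
  (* u / (1 - u) takes every value but -1. *)
  rewrite [RHS](reindex_onto (fun u => u / (1 - u))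
                             (fun w => w / (1 + w))) /=; last first.
    move=> w; rewrite -subr_eq0 opprK => w1; have w1' : 1 + w != 0 by rewrite addrC.
    have -> : 1 - w / (1 + w) = (1 + w)^-1 by field.
    by rewrite invrK mulfVK.
  apply: eq_big => [u|u u1].
    have [->|u1] := eqVneq u 1.
      by rewrite subrr invr0 mulr0 mul0r [0 == 1]eq_sym oner_eq0 andbF.
    have u1' : 1 - u != 0 by rewrite subr_eq0 eq_sym.
    have e : 1 + u / (1 - u) = (1 - u)^-1 by field.
    have -> : u / (1 - u) != -1 by rewrite -subr_eq0 opprK addrC e invr_eq0.
    by rewrite e invrK mulfVK ?eqxx.
  by rewrite qchar_conjV -?(qcharM Q).
rewrite (eq_bigr psi) => [|t t0]; last by rewrite (qchar_norm Q) // geval1 mul1r.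
rewrite sum_psi_neq0 gevalN gevalM // gevalD gevalN geval1.
by rewrite geval_nat; ring.
Qed.

(** Eliminating the conjugate Gauss sum between the two products above. *)
Lemma gauss_sum_pow4 : gauss_sum chi ^+ 4 = ev J ^+ 2 * #|F|%:R.
Proof.
have chiN1_sq : ev (chi (-1)) ^+ 2 = 1.
  by rewrite -gevalX // -/(rho _) (qchar2N1 Q) geval1.
apply: (mulIf F_neq0).
rewrite -{1}gauss_sum_rho.
have -> : gauss_sum chi ^+ 4 * gauss_sum rho ^+ 2
    = (gauss_sum chi * (gauss_sum chi * gauss_sum rho)) ^+ 2 by ring.
rewrite gauss_sum_chi_rho mulrCA gauss_sum_chi_conj !exprMn chiN1_sq.
by ring.
Qed.

Variables (q : nat).
Hypotheses (charL : q \in [pchar L]) (q_F : q%:R != 0 :> F).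

Lemma geval_frob (z : gaussint) : ev z ^+ q = geval (i ^+ q) z.
Proof.
rewrite -[LHS](pFrobenius_autE charL) /geval rmorphD rmorphM !rmorph_int /=.
by rewrite pFrobenius_autE.
Qed.

Lemma gauss_sum_frob :
  gauss_sum chi ^+ q = geval (i ^+ q) (gconj (chi q%:R))
                       * \sum_v geval (i ^+ q) (chi v) * psi v.
Proof.
have iq2 : i ^+ q * i ^+ q = -1.
  rewrite -exprMn i2 -(pFrobenius_autE charL) rmorphN rmorph1 //.
have psiX v n : psi v ^+ n = psi (n%:R * v).
  elim: n => [|n IH]; first by rewrite mul0r psi0.
  by rewrite exprS IH -psiD -natr1 mulrDl mul1r addrC.
rewrite -[LHS](pFrobenius_autE charL) rmorph_sum /=.
rewrite mulr_sumr [RHS](reindex (fun v => q%:R * v)) /=; last first.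
  by exists (fun u => q%:R^-1 * u) => u _; [rewrite mulKf|rewrite mulVKf].
apply: eq_bigr => v _; rewrite pFrobenius_autE exprMn geval_frob psiX.
rewrite mulrA -gevalM // (qcharM Q) mulrA [gconj _ * _]mulrC (qchar_norm Q) //.
by rewrite mul1r.
Qed.

(** Comparing [gauss_sum chi ^+ q], computed by the Frobenius map, with its value
    from [gauss_sum_pow4]; [pi] is a Gaussian integer of norm [#|F|]. *)
Lemma gauss_sum_reciprocity (pi : gaussint) : odd q ->
  J ^+ 2 = pi ^+ 2 -> pi * gconj pi = #|F|%:R ->
  ev (chi (if (q %% 4 == 1)%N then q%:R else - q%:R))
    * geval (- i ^+ q) pi ^+ (q.+1 %/ 4)%N = geval (i ^+ q) pi ^+ (q.+1 %/ 4)%N.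
Proof.
move=> q_odd Jpi pinorm.
have evN : ev pi * ev (gconj pi) = #|F|%:R.
  by rewrite -gevalM // pinorm geval_nat.
have pi0 : ev pi != 0 by apply: contra F_neq0 => /eqP pi0; rewrite -evN pi0 mul0r.
have G4 : gauss_sum chi ^+ 4 = ev pi ^+ 3 * ev (gconj pi).
  by rewrite gauss_sum_pow4 -evN -!gevalX // Jpi !gevalX //; ring.
have G0 : gauss_sum chi != 0.
  apply/eqP => G0; move/eqP: G4; rewrite G0 expr0n eq_sym mulf_eq0 expf_eq0.
  rewrite (negPf pi0) /= => /eqP h; move: F_neq0.
  by rewrite -evN h mulr0 eqxx.
have i4 : i ^+ 4 = 1 by rewrite -[4%N]/(2 * 2)%N exprM [i ^+ 2]expr2 i2 sqrrN expr1n.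
set n := (q.+1 %/ 4)%N; have frob := gauss_sum_frob; have frob_pi := geval_frob pi.
(* For q = 1 mod 4 the Frobenius map fixes i and multiplies the Gauss sum by the
   inverse of chi q; for q = 3 mod 4 it takes it to chi q times its conjugate. *)
case: ifP => [/eqP q1|/eqP q1].
  have qE : q = (4 * n).+1 by rewrite /n; lia.
  have iq : i ^+ q = i by rewrite qE exprS exprM i4 expr1n mulr1.
  rewrite iq in frob frob_pi *; rewrite -geval_conj.
  have pi1 : ev pi ^+ (4 * n) = 1.
    by apply: (mulfI pi0); rewrite -exprS -qE frob_pi mulr1.
  have {}frob : (ev pi ^+ 3 * ev (gconj pi)) ^+ n = ev (gconj (chi q%:R)).
    apply: (mulfI G0); rewrite -G4 -exprM -exprS -qE frob mulrC //.
  have cc : ev (chi q%:R) * ev (gconj (chi q%:R)) = 1.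
    by rewrite -gevalM // (qchar_norm Q) // geval1.
  rewrite -[RHS]mul1r -cc -frob exprMn -exprM.
  transitivity (ev (chi q%:R) * ev (gconj pi) ^+ n * ev pi ^+ (4 * n)).
    by rewrite pi1 mulr1.
  by rewrite (_ : 4 * n = 3 * n + n)%N ?exprD; [ring|lia].
have qE : q.+1 = (4 * n)%N by rewrite /n; move: q_odd q1; lia.
have iq : i ^+ q = - i.
  apply: (mulfI (x := i)).
    by apply/eqP => h; move/eqP: i2; rewrite h mul0r eq_sym oppr_eq0 oner_eq0.
  by rewrite -exprS qE exprM i4 expr1n mulrN i2 opprK.
rewrite iq opprK in frob frob_pi *.
have {}frob : (ev pi ^+ 3 * ev (gconj pi)) ^+ n = ev (chi (- q%:R)) * #|F|%:R.
  rewrite -G4 -exprM -qE exprS frob -geval_conj gconjK mulrCA.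
  under eq_bigr do rewrite -geval_conj.
  by rewrite gauss_sum_chi_conj mulrA -gevalM // -(qcharM Q) mulrN1.
rewrite -geval_conj in frob_pi *.
have pi1 : ev pi ^+ (4 * n) = #|F|%:R by rewrite -qE exprS frob_pi evN.
apply: (mulfI (x := ev pi ^+ (3 * n))); first by rewrite expf_neq0.
rewrite exprM -[RHS]exprMn frob -pi1 -exprM mulrCA -exprD.
by congr (_ * _ ^+ _); lia.
Qed.

End GaussSums.

(** * Reciprocity for the quartic character of an odd rational prime *)

(** Reciprocity holds for the associate of [q] that is 1 modulo 4. *)
Definition qstar (q : nat) : int := if (q %% 4 == 1)%N then q%:Z else - q%:Z.

(** A root of [1 + 'X + ... + 'X^(p - 1)] is a [p]-th root of unity; it is not 1, as
    [p] is nonzero in [L]. *)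
Lemma exists_additive_char (p : nat) (L : closedFieldType) :
    prime p -> p%:R != 0 :> L ->
  exists psi : 'F_p -> L, [/\ forall u v, psi (u + v) = psi u * psi v,
    \sum_v psi v = 0 & psi 0 = 1].
Proof.
move=> p_pr pL; have p_gt1 := prime_gt1 p_pr.
have sz : size (\poly_(k < p) (1 : L)) = p.
  by apply: size_poly_eq; rewrite oner_eq0.
have /closed_rootP[z /rootP] : size (\poly_(k < p) (1 : L)) != 1%N.
  by rewrite sz gtn_eqF.
rewrite horner_poly; under eq_bigr do rewrite mul1r; move=> zsum.
have zp : z ^+ p = 1 by apply/eqP; rewrite -subr_eq0 subrX1 zsum mulr0.
have zX n : z ^+ (n %% p) = z ^+ n by rewrite expr_mod.
exists (fun v => z ^+ v); split; last by [].
  by move=> u v; rewrite /= [X in (_ %% X)%N](Fp_cast p_pr) zX exprD.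
by rewrite -[RHS]zsum /= -!(big_mkord xpredT) (Fp_cast p_pr).
Qed.

Section PrimeSubfield.
Variables (K : finFieldType) (q : nat).
Hypothesis charK : q \in [pchar K].

Lemma natr_pchar_inj m n : (m < q)%N -> (n < q)%N -> m%:R = n%:R :> K -> m = n.
Proof.
wlog le_mn : m n / (m <= n)%N => [hw mq nq h|mq nq h].
  by case/orP: (leq_total m n) => ?; [apply: hw|apply/esym/hw].
have /eqP : (n - m)%:R = 0 :> K by rewrite natrB // h subrr.
rewrite -(dvdn_pcharf charK) => /dvdnP[[|k] hk]; first lia.
by have := leq_subr m n; rewrite hk mulSn; lia.
Qed.

(** The polynomial ['X^q - 'X] has no room for a root outside the prime field. *)
Lemma frobenius_fixed (c : K) : c ^+ q = c -> exists2 k, (k < q)%N & c = k%:R.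
Proof.
move=> cq; have q_gt1 := prime_gt1 (pcharf_prime charK).
pose rs := [seq k%:R : K | k <- iota 0 q].
have [/mapP[k]|crs] := boolP (c \in rs).
  by rewrite mem_iota => /andP[_ kq] ->; exists k.
have szP : size ('X^q - 'X : {poly K}) = q.+1.
  by rewrite size_polyDl ?size_polyXn // size_polyN size_polyX ltnS.
have : (size (c :: rs) < size ('X^q - 'X : {poly K})%R)%N.
  apply: max_poly_roots.
  - by rewrite -size_poly_eq0 szP.
  - apply/allP => y; rewrite inE rootE !hornerE subr_eq0.
    case/orP=> [/eqP->|/mapP[k _ ->]]; first by rewrite cq.
    by rewrite -[X in X == _](pFrobenius_autE charK) rmorph_nat.
  rewrite /= crs map_inj_in_uniq ?iota_uniq // => k l.
  by rewrite !mem_iota => kq lq /natr_pchar_inj; apply.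
by rewrite szP /= size_map size_iota ltnn.
Qed.

End PrimeSubfield.

Lemma lift4_geval (F : fieldType) (j : F) z : j * j = -1 -> 2 != 0 :> F ->
  gmu4 z -> lift4 j (geval j z) = z.
Proof.
move=> j2 two; rewrite /gmu4 !inE => /or4P[||| /orP[]] /eqP->;
by rewrite ?gevalN ?gevali ?geval1 ?geval0 ?lift4E.
Qed.

(** The group [w ^ (4 n) = 1] in characteristic [q], with [4 n = q - 1] (the split
    torus) or [4 n = q + 1] (the norm-one torus), and its Cayley parametrization
    [c |-> (a + c j') / (a - c j')], which misses only [w = -1]. *)
Section CayleyTorus.
Variables (K : finFieldType) (q n : nat) (z : K).
Hypotheses (charK : q \in [pchar K]) (q_odd : odd q).
Hypotheses (nE : n = (q.+1 %/ 4)%N) (z_prim : (4 * n).-primitive_root z).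

Local Notation j := (z ^+ n).
Local Notation j' := (j ^+ q).

Lemma torus_n_gt0 : (0 < n)%N.
Proof. by have := prime_gt1 (pcharf_prime charK); rewrite nE; move: q_odd; lia. Qed.

Lemma torus_two_neq0 : 2 != 0 :> K.
Proof.
rewrite -(dvdn_pcharf charK) dvdn_prime2 ?(pcharf_prime charK) //.
by apply: contraL q_odd => /eqP->.
Qed.

Lemma torus_j2 : j * j = -1.
Proof.
have n0 := torus_n_gt0.
have : (j * j) ^+ 2 = 1 ^+ 2.
  by rewrite -expr2 -!exprM expr1n mulnC (prim_expr_order z_prim).
move/eqP; rewrite eqf_sqr -exprD => /orP[|/eqP//].
rewrite -(prim_order_dvd z_prim) => /dvdn_leq; lia.
Qed.

Lemma torus_j_frob : j' = if (q %% 4 == 1)%N then j else - j.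
Proof.
have j2 := torus_j2.
have j4 : j ^+ 4 = 1 by rewrite -[4%N]/(2 * 2)%N exprM [j ^+ 2]expr2 j2 sqrrN expr1n.
have : (q %% 4 == 1)%N || (q %% 4 == 3)%N by move: q_odd; lia.
have qE : j ^+ q = j ^+ (q %% 4).
  by rewrite {1}(divn_eq q 4) exprD mulnC exprM j4 expr1n mul1r.
case/orP=> /eqP h; rewrite qE h //=.
by rewrite -[3%N]/(2 + 1)%N exprD [j ^+ 2]expr2 j2 mulN1r.
Qed.

Lemma torus_j'2 : j' * j' = -1.
Proof. by rewrite torus_j_frob; case: ifP => _; rewrite ?mulrNN torus_j2. Qed.

Lemma torus_j'_neq0 : j' != 0.
Proof.
apply/eqP => h; move/eqP: torus_j'2.
by rewrite h mul0r eq_sym oppr_eq0 oner_eq0.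
Qed.

Variable a : int.
Hypothesis a_q : ~~ (q%:Z %| a)%Z.

Lemma torus_a_neq0 : a%:~R != 0 :> K.
Proof. by rewrite -(dvdz_pcharf charK). Qed.

(** The default [0^-1 = 0] makes this 0 when [a ^ 2 + c ^ 2] vanishes modulo [q]. *)
Definition torus_pt (c : nat) : K :=
  geval j' (Gauss a c) / geval (- j') (Gauss a c).

Lemma torus_num_den (c : nat) :
  geval j' (Gauss a c) * geval (- j') (Gauss a c) = (a ^+ 2 + c%:Z ^+ 2)%:~R.
Proof.
by rewrite -geval_conj -gevalM ?torus_j'2 // gnormE geval_int.
Qed.

Lemma torus_pt_eq0 c : (torus_pt c == 0) = (q%:Z %| a ^+ 2 + c%:Z ^+ 2)%Z.
Proof.
by rewrite (dvdz_pcharf charK) -torus_num_den /torus_pt !mulf_eq0 invr_eq0.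
Qed.

Lemma torus_pt_mod c : torus_pt (c %% q) = torus_pt c.
Proof.
have h : (c %% q)%N%:Z%:~R = c%:Z%:~R :> K by apply: GRing.natr_mod_pchar.
by rewrite /torus_pt /geval /= h.
Qed.

Lemma frob_torus_pt c :
  torus_pt c ^+ q = if (q %% 4 == 1)%N then torus_pt c else (torus_pt c)^-1.
Proof.
rewrite /torus_pt expr_div_n !(geval_frob _ charK).
have Nj : (- j') ^+ q = - j' ^+ q.
  by rewrite -!(pFrobenius_autE charK) rmorphN.
rewrite Nj torus_j_frob; case: ifP => h.
  by rewrite [X in geval X]torus_j_frob [X in geval (- X)]torus_j_frob h.
have -> : (- j) ^+ q = j.
  rewrite -(pFrobenius_autE charK) rmorphN /= pFrobenius_autE.
  by rewrite torus_j_frob h opprK.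
by rewrite opprK invfM invrK mulrC.
Qed.

(** The torus is where the Frobenius map is the identity or the inversion. *)
Lemma exp_torusE (w : K) : w != 0 ->
  (w ^+ (4 * n) == 1) = (w ^+ q == if (q %% 4 == 1)%N then w else w^-1).
Proof.
move=> w0; have n0 := torus_n_gt0; case: ifP => [/eqP h|/eqP h].
  have -> : q = (4 * n).+1 by rewrite nE; lia.
  by rewrite exprS -{4}[w]mulr1 (inj_eq (mulfI w0)).
have qE : (4 * n)%N = q.+1 by rewrite nE; move: q_odd h; lia.
by rewrite qE exprS -[in RHS](inj_eq (mulfI w0)) divff.
Qed.

Lemma torus_pt_neqN1 c : torus_pt c != -1.
Proof.
apply/eqP => h; have d0 : geval (- j') (Gauss a c) != 0.
  apply/eqP => d0; move/eqP: h; rewrite /torus_pt d0 invr0 mulr0 eq_sym.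
  by rewrite oppr_eq0 oner_eq0.
have := congr1 (fun w => w * geval (- j') (Gauss a c)) h.
rewrite /torus_pt mulfVK // mulN1r /geval /= => e.
have : 2 * a%:~R = 0 :> K.
  have -> : 2 * a%:~R = (a%:~R + c%:~R * j') + (a%:~R + c%:~R * - j') :> K by ring.
  by rewrite e addNr.
by move/eqP; rewrite mulf_eq0 (negPf torus_two_neq0) (negPf torus_a_neq0).
Qed.

Lemma torus_pt_inj c d : (c < q)%N -> (d < q)%N ->
  torus_pt c != 0 -> torus_pt c = torus_pt d -> c = d.
Proof.
move=> cq dq; rewrite /torus_pt => c0 e.
have den_c : geval (- j') (Gauss a c) != 0.
  by apply: contraNneq c0 => ->; rewrite invr0 mulr0.
have den_d : geval (- j') (Gauss a d) != 0.
  by apply: contraNneq c0 => h; rewrite e h invr0 mulr0.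
apply: (natr_pchar_inj charK) => //.
have /eqP := e; rewrite eqr_div // /geval /= => /eqP {}e.
have : 2 * a%:~R * j' * (c%:R - d%:R) = 0.
  move: e; rewrite -[c%:~R]/(c%:R) -[d%:~R]/(d%:R).
  move: (a%:~R) j' (c%:R : K) (d%:R : K) => A J u v e.
  transitivity ((A + u * J) * (A + v * - J) - (A + v * J) * (A + u * - J)).
    by ring.
  by rewrite e subrr.
move/eqP; rewrite !mulf_eq0 (negPf torus_two_neq0) (negPf torus_a_neq0).
by rewrite (negPf torus_j'_neq0) /= subr_eq0 => /eqP.
Qed.

Lemma torus_pt_surj (w : K) : w ^+ (4 * n) = 1 -> w != -1 ->
  exists2 c, (c < q)%N & torus_pt c = w.
Proof.
move=> w1 wN1.
have w0 : w != 0.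
  apply/eqP => w0; move/eqP: w1; rewrite w0 expr0n.
  by rewrite muln_eq0 /= (gtn_eqF torus_n_gt0) eq_sym oner_eq0.
have wq : w ^+ q = if (q %% 4 == 1)%N then w else w^-1.
  by apply/eqP; rewrite -exp_torusE // w1.
have w1' : w + 1 != 0 by rewrite addr_eq0.
have J0 := torus_j'_neq0; have a0 := torus_a_neq0; have two := torus_two_neq0.
(* c inverts the Cayley map, and it is fixed by the Frobenius map. *)
pose c := a%:~R / j' * ((w - 1) / (w + 1)).
have [k kq ck] : exists2 k, (k < q)%N & c = k%:R.
  apply: (frobenius_fixed charK); rewrite -(pFrobenius_autE charK).
  rewrite /c !rmorphM !fmorphV rmorphB rmorphD !rmorph1 rmorph_int.
  rewrite /= !(pFrobenius_autE charK) wq.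
  have -> : j' ^+ q = if (q %% 4 == 1)%N then j' else - j'.
    have := torus_j_frob; case: ifP => h jE; first by rewrite [X in X ^+ q]jE.
    rewrite [X in X ^+ q]jE.
    by rewrite -(pFrobenius_autE charK) rmorphN /= pFrobenius_autE.
  case: ifP => _ //; field.
  by rewrite J0 w0 w1' oppr_eq0 J0.
exists k => //; rewrite /torus_pt /geval /= -[k%:~R]/(k%:R) -ck /c.
field; rewrite J0 w1' /= (_ : _ + _ = 2 * (a%:~R * j')); last by ring.
by rewrite !mulf_neq0.
Qed.

Lemma sum_torus (g : K -> gaussint) : g 0 = 0 ->
  \sum_(c < q) g (torus_pt c) = \sum_(k < 4 * n) g (z ^+ k) - g (-1).
Proof.
move=> g0; rewrite (bigID (fun c : 'I_q => torus_pt c != 0)) /=.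
rewrite [X in _ + X]big1 ?addr0 => [|c]; last by rewrite negbK => /eqP->.
have N1T : (-1) ^+ (4 * n) = 1 :> K.
  by rewrite -[4%N]/(2 * 2)%N -mulnA exprM sqrrN expr1n expr1n.
rewrite -(big_imset g (h := fun c : 'I_q => torus_pt c)) /=; last first.
  by move=> c d c0 _ /torus_pt_inj h; apply/val_inj/h.
rewrite -(big_imset g (h := fun k : 'I_(4 * n) => z ^+ k) (A := predT)) /=; last first.
  move=> k l _ _ /eqP; rewrite (eq_prim_root_expr z_prim) !modn_small //.
  by move/eqP/val_inj.
rewrite [X in _ = X - _](bigD1 (-1)) /=; last first.
  by have [k ->] := prim_rootP z_prim N1T; apply: imset_f.
rewrite addrAC subrr add0r; apply: eq_bigl => w.
apply/imsetP/andP => [[c + ->]|[/imsetP[k _ wE] wN1]].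
  move=> c0; split; last exact: torus_pt_neqN1.
  have : torus_pt c ^+ (4 * n) = 1.
    by apply/eqP; rewrite exp_torusE // frob_torus_pt.
  by case/(prim_rootP z_prim) => k ->; apply: imset_f.
have w1 : w ^+ (4 * n) = 1 by rewrite wE exprAC (prim_expr_order z_prim) expr1n.
have [c cq cw] := torus_pt_surj w1 wN1.
exists (Ordinal cq); last by rewrite -cw.
change (torus_pt c != 0); rewrite cw wE expf_neq0 //.
apply/eqP => z0; have := prim_expr_order z_prim; rewrite z0 expr0n muln_eq0 /=.
by rewrite (gtn_eqF torus_n_gt0) => /eqP; rewrite eq_sym oner_eq0.
Qed.

Definition torus_char (c : nat) : gaussint := lift4 j (torus_pt c ^+ n).

Lemma torus_pt_mu4 c : (torus_pt c ^+ n) ^+ 5 = torus_pt c ^+ n.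
Proof.
have [->|c0] := eqVneq (torus_pt c) 0.
  by rewrite expr0n (gtn_eqF torus_n_gt0) expr0n.
rewrite exprSr -exprM mulnC (_ : _ ^+ (4 * n) = 1) ?mul1r //.
by apply/eqP; rewrite exp_torusE // frob_torus_pt.
Qed.

Lemma torus_char_eq0 c : (torus_char c == 0) = (q%:Z %| a ^+ 2 + c%:Z ^+ 2)%Z.
Proof.
have [j2 two] := (torus_j2, torus_two_neq0).
have <- : (torus_pt c ^+ n == 0) = (q%:Z %| a ^+ 2 + c%:Z ^+ 2)%Z.
  by rewrite -torus_pt_eq0 expf_eq0 torus_n_gt0.
rewrite /torus_char.
have := mu4P j2 (torus_pt_mu4 c); rewrite !inE.
have [j1 N1 Nj [Nj1 Njj j0]] := sqrtN1_distinct j2 two.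
move=> /or4P[||| /orP[]] /eqP->; rewrite ?lift4E ?eqxx //;
by rewrite ?oppr_eq0 ?oner_eq0 ?(negPf j0).
Qed.

(** Over all [4 n]-th roots of unity the sum is geometric, of ratio [gi ^+ e]; the
    last term is the correction for the root -1. *)
Lemma sum_torus_char e : (0 < e)%N ->
  \sum_(c < q) torus_char c ^+ e
    = (if (4 %| e)%N then (4 * n)%:R else 0) - (-1) ^+ (n * e).
Proof.
have [j2 two] := (torus_j2, torus_two_neq0); move=> e_gt0.
rewrite (@sum_torus (fun w => lift4 j (w ^+ n) ^+ e)); last first.
  by rewrite expr0n (gtn_eqF torus_n_gt0) (lift4_0 j2) // expr0n gtn_eqF.
have -> : lift4 j ((-1) ^+ n) = (-1) ^+ n.
  rewrite -(signr_odd K) -(signr_odd gaussint).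
  by case: (odd n); [rewrite !expr1 lift4_N1 | rewrite !expr0 lift4_1].
rewrite -exprM; congr (_ - _).
have j5 : j ^+ 5 = j.
  by rewrite -[5%N]/(2 + 2 + 1)%N !exprD [j ^+ 2]expr2 j2 mulrNN mulr1 mul1r.
have -> : \sum_(k < 4 * n) lift4 j ((z ^+ k) ^+ n) ^+ e
    = \sum_(k < 4 * n) (gi ^+ e) ^+ k.
  by apply: eq_bigr => k _; rewrite exprAC (lift4X j2) // lift4_j // exprAC.
have gi4 : gi ^+ 4 = 1 by [].
have giE : gi ^+ e = gi ^+ (e %% 4) by rewrite expr_mod.
case: ifP => [/eqP e4|e4].
  by rewrite giE e4 expr0; under eq_bigr do rewrite expr1n;
     rewrite sumr_const card_ord.
have gie4 : (gi ^+ e) ^+ 4 = 1 by rewrite exprAC gi4 expr1n.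
apply: (@gauss_mulf_eq0 (gi ^+ e - 1)).
  by rewrite -subrX1 exprM gie4 expr1n subrr.
rewrite giE; move: e4; rewrite /dvdn; have := ltn_pmod e (isT : 0 < 4)%N.
by case: (e %% 4)%N => [|[|[|[|]]]].
Qed.

End CayleyTorus.

(** The reciprocity step happens in an extension [L] of [K] that contains a
    [p]-th root of unity; its outcome lies in [K], which does not depend on [p]. *)
Lemma torus_char_reciprocity (K : finFieldType) (q n : nat) (z : K) (a : int)
    (p c : nat) (p_pr : prime p) (pE : p%:Z = a ^+ 2 + c%:Z ^+ 2) :
    q \in [pchar K] -> odd q -> n = (q.+1 %/ 4)%N -> (4 * n).-primitive_root z ->
    ~~ (q%:Z %| a)%Z -> (a = 1 %[mod 4])%Z -> (2 %| c%:Z)%Z -> p != q ->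
  qchar (p %/ 4) (sqrtN1 p a c) (qstar q)%:~R = torus_char q n z a c.
Proof.
move=> charK q_odd nE z_prim a_q a1 c_even pq.
have q_pr := pcharf_prime charK.
have Q := two_squares_quartic p_pr pE a1 c_even.
have j2 := torus_j2 charK q_odd nE z_prim.
have two := torus_two_neq0 charK q_odd.
have [L [phi _]] := countable_algebraic_closure K.
have charL : q \in [pchar L] by rewrite (fmorph_pchar phi).
have pK : p%:R != 0 :> K by rewrite -(dvdn_pcharf charK) dvdn_prime2 // eq_sym.
have pL : p%:R != 0 :> L by rewrite -(rmorph_nat phi) fmorph_eq0.
have [psi [psiD psi_sum psi0]] := exists_additive_char p_pr pL.
have i2 : phi (z ^+ n) * phi (z ^+ n) = -1 by rewrite -rmorphM j2 rmorphN rmorph1.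
have phi_geval (j : K) u : geval (phi j) u = phi (geval j u).
  by rewrite /geval rmorphD rmorphM !rmorph_int.
have q_F : q%:R != 0 :> 'F_p.
  by rewrite -(dvdn_pcharf (pchar_Fp p_pr)) dvdn_prime2.
have Jpi : jacobi_sum (p %/ 4) (sqrtN1 p a c) ^+ 2 = Gauss a c ^+ 2.
  rewrite (jacobi_sumE p_pr pE a1 c_even) exprMn sqrrN.
  by rewrite -/(qchar2 _ _ _) (qchar2N1 Q) mul1r.
have pinorm : Gauss a c * gconj (Gauss a c) = #|'F_p|%:R.
  by rewrite gnormE /= -pE card_Fp.
have F_neq0 : #|'F_p|%:R != 0 :> L by rewrite card_Fp.
have := gauss_sum_reciprocity Q i2 psiD psi_sum psi0 F_neq0 charL q_F q_odd Jpi pinorm.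
rewrite -nE -rmorphXn -rmorphN !phi_geval -!rmorphXn -rmorphM => /fmorph_inj.
have -> : (if (q %% 4 == 1)%N then q%:R else - q%:R) = (qstar q)%:~R :> 'F_p.
  by rewrite /qstar; case: ifP => _; rewrite ?rmorphN.
move=> recK; have := torus_num_den charK q_odd nE z_prim a c; rewrite -pE => nd.
have den0 : geval (- (z ^+ n) ^+ q) (Gauss a c) != 0.
  by apply: contra pK => /eqP d0; rewrite -[p%:R]/(p%:~R) -nd d0 mulr0.
rewrite /torus_char /torus_pt expr_div_n -recK mulfK ?expf_neq0 //.
by rewrite (lift4_geval j2) //; apply: qchar_mu4.
Qed.

(** The sum over [c] modulo [q] of the [k]-th power of the residue character at
    [q]: a sum over all [4 n]-th roots of unity, [n = q.+1 %/ 4], minus the term of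
    the root -1 that the Cayley parametrization misses. *)
Definition residue_power_sum (q k : nat) : gaussint :=
  (if (4 %| k)%N then (4 * (q.+1 %/ 4))%:R else 0) - (-1) ^+ ((q.+1 %/ 4) * k).

(** For each odd prime [q] the quartic character of [qstar q] modulo a prime
    [p = a ^ 2 + c ^ 2] is a function of [c] modulo [q], whose power sums over the
    residue classes are explicit. *)
Lemma exists_residue_char (q : nat) (a : int) :
    prime q -> odd q -> ~~ (q%:Z %| a)%Z -> (a = 1 %[mod 4])%Z ->
  exists theta : nat -> gaussint,
  [/\ forall c, gmu4 (theta c),
      forall c, theta (c %% q)%N = theta c,
      forall c, (theta c == 0) = (q%:Z %| a ^+ 2 + c%:Z ^+ 2)%Z,
      forall p c, prime p -> p%:Z = a ^+ 2 + c%:Z ^+ 2 -> (2 %| c)%N -> p != q ->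
        qchar (p %/ 4) (sqrtN1 p a c) (qstar q)%:~R = theta c
    & forall k, (0 < k)%N -> \sum_(c < q) theta c ^+ k = residue_power_sum q k].
Proof.
move=> q_pr q_odd a_q a1.
(* The field with q ^ 2 elements contains the 4 n-th roots of unity, since 4 n is
   q - 1 or q + 1. *)
have [K charK cardK] := pPrimePowerField q_pr (isT : 0 < 2)%N.
have [w w_prim] := finField_generator K.
have dvdN : (4 * (q.+1 %/ 4) %| #|K|.-1)%N.
  have -> : #|K|.-1 = (q.-1 * q.+1)%N.
    by rewrite cardK; case: q q_odd {q_pr a_q charK cardK} => //= q _; lia.
  have /orP[/eqP h|/eqP h] : (q %% 4 == 1)%N || (q %% 4 == 3)%N by move: q_odd; lia.
    by apply: dvdn_mulr; rewrite (_ : 4 * _ = q.-1)%N //; lia.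
  by apply: dvdn_mull; rewrite (_ : 4 * _ = q.+1)%N //; lia.
have z_prim := dvdn_prim_root w_prim dvdN; set z := _ ^+ _ in z_prim.
exists (torus_char q (q.+1 %/ 4) z a); split.
- by move=> c; apply: lift4_mu4.
- by move=> c; rewrite /torus_char torus_pt_mod.
- exact: torus_char_eq0.
- by move=> p c *; apply: torus_char_reciprocity.
exact: sum_torus_char.
Qed.

(** * Counting residue classes *)

Lemma sum_mod_coprime (m n : nat) (f g : nat -> gaussint) :
    (0 < m)%N -> (0 < n)%N -> coprime m n ->
    (forall c, f (c %% m)%N = f c) -> (forall c, g (c %% n)%N = g c) ->
  \sum_(c < m * n) f c * g c = (\sum_(c < m) f c) * (\sum_(c < n) g c).
Proof.
move=> m0 n0 mn fm gn.
have mn0 : (0 < m * n)%N by rewrite muln_gt0 m0.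
rewrite mulr_suml; under eq_bigr => c _ do rewrite -fm -gn.
under [RHS]eq_bigr do rewrite mulr_sumr.
rewrite pair_big /=.
pose h (u : 'I_m * 'I_n) : 'I_(m * n) :=
  Ordinal (ltn_pmod (chinese m n u.1 u.2) mn0).
have hl u : (h u %% m = u.1)%N.
  by rewrite /= modn_dvdm ?dvdn_mulr // chinese_modl // modn_small.
have hr u : (h u %% n = u.2)%N.
  by rewrite /= modn_dvdm ?dvdn_mull // chinese_modr // modn_small.
rewrite (reindex h).
  by apply: eq_bigr => u _; rewrite hl hr.
exists (fun c : 'I_(m * n) => (Ordinal (ltn_pmod c m0), Ordinal (ltn_pmod c n0))).
  move=> [u v] _; have := (hl (u, v), hr (u, v)); move: (h _) => c [] /= cu cv.
  by congr pair; apply: val_inj.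
move=> c _; apply: val_inj => /=.
rewrite -[RHS](modn_small (ltn_ord c)); apply/eqP.
by rewrite chinese_remainder // chinese_modl // chinese_modr // !modn_mod !eqxx.
Qed.

(** Chinese remainder theorem, one prime at a time. *)
Lemma sum_mod_primes (M : nat) (s : seq nat) (g : nat -> gaussint)
    (f : nat -> nat -> gaussint) :
    (0 < M)%N -> all prime s -> uniq s -> all (fun q => coprime M q) s ->
    (forall c, g (c %% M)%N = g c) ->
    (forall q, q \in s -> forall c, f q (c %% q)%N = f q c) ->
  \sum_(c < M * \prod_(q <- s) q) g c * \prod_(q <- s) f q c
    = (\sum_(c < M) g c) * \prod_(q <- s) \sum_(c < q) f q c.
Proof.
elim: s M g => [|q s IH] M g M0 /=.
  by rewrite !big_nil mulr1 muln1 => *; under eq_bigr do rewrite big_nil mulr1.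
case/andP=> q_pr s_pr /andP[qs us] /andP[Mq Ms] gM fq.
have q0 := prime_gt0 q_pr.
have fqq := fq q (mem_head _ _).
rewrite !big_cons mulnA mulrA -(sum_mod_coprime M0 q0 Mq gM fqq).
rewrite -(IH (M * q)%N (fun c => g c * f q c)) ?muln_gt0 ?M0 //.
- by apply: eq_bigr => c _; rewrite big_cons mulrA.
- apply/allP => l ls; rewrite coprimeMl (allP Ms) //= prime_coprime //.
  rewrite dvdn_prime2 ?(allP s_pr _ ls) //.
  by apply: contraNneq qs => ->.
- move=> c; rewrite -gM -[in RHS]gM modn_dvdm ?dvdn_mulr //; congr (_ * _).
  by rewrite -fqq -[in RHS]fqq modn_dvdm ?dvdn_mull.
by move=> l ls; apply: fq; rewrite inE ls orbT.
Qed.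

(** On 0 and the fourth roots of unity, [z ^ 4 + z + z ^ 2 + z ^ 3] is four times the
    indicator of 1; the variant below negates the odd powers. *)
Lemma count_eq1 (M : nat) (f : nat -> gaussint) : (forall c, gmu4 (f c)) ->
  4 * (#|[pred c : 'I_M | f c == 1]|)%:R
    = \sum_(c < M) f c ^+ 4 + \sum_(c < M) f c ^+ 1
      + \sum_(c < M) f c ^+ 2 + \sum_(c < M) f c ^+ 3.
Proof.
move=> fmu; rewrite -sum1_card natr_sum big_mkcond mulr_sumr -!big_split /=.
apply: eq_bigr => c _; rewrite inE.
by have := fmu c; rewrite /gmu4 !inE => /or4P[||| /orP[]] /eqP->.
Qed.

Lemma count_eqN1 (M : nat) (f : nat -> gaussint) : (forall c, gmu4 (f c)) ->
  4 * (#|[pred c : 'I_M | f c == -1]|)%:R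
    = \sum_(c < M) f c ^+ 4 - \sum_(c < M) f c ^+ 1
      + \sum_(c < M) f c ^+ 2 - \sum_(c < M) f c ^+ 3.
Proof.
move=> fmu; rewrite -sum1_card natr_sum big_mkcond mulr_sumr.
rewrite -!sumrN -!big_split /=.
apply: eq_bigr => c _; rewrite inE.
by have := fmu c; rewrite /gmu4 !inE => /or4P[||| /orP[]] /eqP->.
Qed.

Lemma count_neq0 (M : nat) (f : nat -> gaussint) : (forall c, gmu4 (f c)) ->
  (#|[pred c : 'I_M | f c != 0]|)%:R = \sum_(c < M) f c ^+ 4.
Proof.
move=> fmu; rewrite -sum1_card natr_sum big_mkcond.
by apply: eq_bigr => c _; rewrite inE gmu4_exp4 //; case: eqP.
Qed.

Lemma sign_even m k : (-1) ^+ (m * (2 * k)) = 1 :> gaussint.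
Proof. by rewrite mulnCA exprM sqrrN !expr1n. Qed.

Lemma residue_power_sum_4 q k : prime q -> odd q ->
  residue_power_sum q (4 * k) = (tau_prime q)%:R.
Proof.
move=> q_pr q_odd; have q_gt1 := prime_gt1 q_pr.
rewrite /residue_power_sum dvdn_mulr // (_ : 4 * k = 2 * (2 * k))%N; last by lia.
have -> : (4 * (q.+1 %/ 4) = (tau_prime q).+1)%N.
  by rewrite /tau_prime; case: ifP => /eqP h; move: q_odd h; lia.
by rewrite sign_even -natr1 addrK.
Qed.

Lemma residue_power_sum_2 q k : residue_power_sum q (4 * k + 2) = -1.
Proof.
rewrite /residue_power_sum (_ : (4 %| 4 * k + 2)%N = false); last by lia.
by rewrite (_ : 4 * k + 2 = 2 * (2 * k + 1))%N ?sign_even ?sub0r //; lia.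
Qed.

Lemma residue_power_sum_odd q k : odd k ->
  residue_power_sum q k = - (-1) ^+ (q.+1 %/ 4).
Proof.
move=> k_odd; rewrite /residue_power_sum (_ : (4 %| k)%N = false).
  by rewrite sub0r -[in LHS]signr_odd oddM k_odd andbT signr_odd.
by apply/negbTE; apply: contraL k_odd => /dvdnP[l ->]; rewrite oddM andbF.
Qed.

Lemma prime_dvd_prod_primes l s : prime l -> all prime s ->
  (l %| \prod_(q <- s) q)%N = (l \in s).
Proof.
move=> l_pr; elim: s => [|q s IH] /=.
  by rewrite big_nil dvdn1; case: l l_pr => [|[]].
by case/andP=> q_pr /IH {}IH; rewrite big_cons Euclid_dvdM // dvdn_prime2 // IH inE.
Qed.

Lemma prod_primes_gt0 s : all prime s -> (0 < \prod_(q <- s) q)%N.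
Proof.
by elim: s => [|q s IH] /=; rewrite ?big_nil // big_cons
  => /andP[/prime_gt0 q0 /IH]; rewrite muln_gt0 q0.
Qed.

Lemma tau_prod_primes s : all prime s -> uniq s ->
  tau (\prod_(q <- s) q) = (\prod_(q <- s) tau_prime q)%N.
Proof.
move=> s_pr s_uniq; rewrite /tau; apply: perm_big; apply: uniq_perm => //.
  exact: primes_uniq.
move=> l; rewrite mem_primes prod_primes_gt0 //=.
apply/andP/idP => [[l_pr]|ls]; first by rewrite prime_dvd_prod_primes.
have l_pr := allP s_pr _ ls.
by rewrite prime_dvd_prod_primes.
Qed.

Section SignedProduct.

Definition prime_exponent (ps qs : seq nat) (q : nat) : nat :=
  if q \in ps then 1 else if q \in qs then 2 else 3.

Variables (ps qs ls : seq nat).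
Local Notation s := (ps ++ qs ++ ls).
Local Notation e := (prime_exponent ps qs).
Hypothesis s_pr : all (fun p => prime p && odd p) s.
Hypothesis s_uniq : uniq s.

Lemma prime_exponent_gt0 q : (0 < e q)%N.
Proof. by rewrite /prime_exponent; case: ifP => // _; case: ifP. Qed.

Lemma big_prime_exponent (T : Type) (idx : T) (op : Monoid.law idx)
    (F : nat -> nat -> T) :
  \big[op/idx]_(q <- s) F (e q) q
    = op (\big[op/idx]_(q <- ps) F 1%N q)
         (op (\big[op/idx]_(q <- qs) F 2%N q) (\big[op/idx]_(q <- ls) F 3%N q)).
Proof.
move: s_uniq; rewrite cat_uniq => /and3P[_ /hasPn disj].
rewrite cat_uniq => /and3P[_ /hasPn disj' _].
rewrite !big_cat /=; congr (op _ (op _ _)); rewrite !big_seq; apply: eq_bigr => q hq.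
- by rewrite /prime_exponent hq.
- rewrite /prime_exponent hq ifN //.
  by apply: disj; rewrite mem_cat hq.
- rewrite /prime_exponent !ifN //; first by apply: disj'.
  by apply: disj; rewrite mem_cat hq orbT.
Qed.

(** Each [qstar q] is 1 modulo 4, so [D] and the remaining sign agree modulo 4. *)
Lemma signed_product (neg : bool) (D : int) :
    D = (-1) ^+ neg * (\prod_(p <- ps) p)%N%:Z
          * (\prod_(q <- qs) q)%N%:Z ^+ 2 * (\prod_(l <- ls) l)%N%:Z ^+ 3 ->
  exists sgn : bool, D = (-1) ^+ sgn * \prod_(q <- s) qstar q ^+ e q
    /\ (D = (-1) ^+ sgn %[mod 4])%Z.
Proof.
move=> DE.
have qstarE q : qstar q = (-1) ^+ (q %% 4 != 1)%N * q%:Z.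
  by rewrite /qstar; case: eqP => _; rewrite ?expr0 ?expr1 ?mul1r ?mulN1r.
have {}DE : D = (-1) ^+ neg * \prod_(q <- s) q%:Z ^+ e q.
  rewrite (@big_prime_exponent _ 1 *%R (fun k q => q%:Z ^+ k)) /= DE.
  by rewrite !prodrXl expr1 !mulrA -!(big_morph Posz PoszM (erefl 1%:Z)).
have signs r : exists b : bool, \prod_(q <- r) qstar q ^+ e q
    = (-1) ^+ b * \prod_(q <- r) q%:Z ^+ e q.
  elim: r => [|q r [b IH]]; first by exists false; rewrite !big_nil mulr1.
  exists (b (+) (odd (e q) && (q %% 4 != 1)%N)).
  rewrite !big_cons IH qstarE exprMn signr_addb -exprM mulnC.
  rewrite -(signr_odd _ (_ * _)) oddM.
  by case: (_ %% 4 != 1)%N; rewrite /= ?andbF ?andbT; ring.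
have [b hb] := signs s; exists (neg (+) b); split.
  by rewrite hb mulrA -signr_addb -addbA addbb addbF.
have -> : D = (-1) ^+ (neg (+) b) * \prod_(q <- s) qstar q ^+ e q.
  by rewrite hb mulrA -signr_addb -addbA addbb addbF.
suff h : forall r, all (fun p => prime p && odd p) r ->
    exists k : int, \prod_(q <- r) qstar q ^+ e q = 1 + 4 * k.
  have [k ->] := h s s_pr.
  by case: (_ (+) _); rewrite /= ?expr1 ?expr0; lia.
elim=> [|q r IH] /=; first by exists 0; rewrite big_nil.
case/andP=> /andP[q_pr q_odd] /IH[k kE]; rewrite big_cons kE.
have [l lE] : exists l : int, qstar q = 1 + 4 * l.
  by exists ((qstar q - 1) %/ 4)%Z; rewrite /qstar; case: ifP => /eqP; lia.
have [l' l'E] : exists l' : int, qstar q ^+ e q = 1 + 4 * l'.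
  elim: (e q) => [|i [l' IHi]]; first by exists 0.
  by exists (l + l' + 4 * l * l'); rewrite exprS IHi lE; ring.
by exists (k + l' + 4 * k * l'); rewrite l'E; ring.
Qed.

End SignedProduct.

(** The part at the prime 2: the quartic character of [(-1) ^ sgn]. *)
Definition class4 (sgn : bool) (c : nat) : gaussint :=
  if odd c then 0 else (-1) ^+ (sgn && odd c./2).

Lemma class4_mod sgn c : class4 sgn (c %% 4) = class4 sgn c.
Proof.
rewrite /class4 [in RHS](divn_eq c 4).
have -> : odd (c %/ 4 * 4 + c %% 4) = odd (c %% 4) by lia.
by have -> : odd (c %/ 4 * 4 + c %% 4)./2 = odd (c %% 4)./2 by lia.
Qed.

Lemma class4_mu4 sgn c : gmu4 (class4 sgn c).
Proof. by rewrite /class4; case: ifP => // _; case: (_ && _). Qed.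

Lemma gauss_mul_neq0 (z w : gaussint) : (z * w != 0) = (z != 0) && (w != 0).
Proof.
have [->|z0] := eqVneq z 0; first by rewrite mul0r eqxx.
have [->|w0] := eqVneq w 0; first by rewrite mulr0 eqxx.
by apply/eqP => /gauss_mulf_eq0/(_ z0)/eqP; apply/negP.
Qed.

Lemma gauss_exp_neq0 (z : gaussint) n : (0 < n)%N -> (z ^+ n != 0) = (z != 0).
Proof.
case: n => // n _; elim: n => [|n IH]; first by rewrite expr1.
by rewrite exprS gauss_mul_neq0 IH andbb.
Qed.

(** The quartic character of [D] modulo the primes [a ^ 2 + x ^ 2], as a function of
    the class of [x]; [theta q] is the character of [qstar q]. *)
Section ClassCharacter.
Variables (a D : int) (sgn : bool) (s : seq nat) (e : nat -> nat).
Variable theta : nat -> nat -> gaussint.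
Hypothesis s_pr : all (fun p => prime p && odd p) s.
Hypothesis s_uniq : uniq s.
Hypothesis e_gt0 : forall q, (0 < e q)%N.
Hypothesis a1 : (a = 1 %[mod 4])%Z.
Hypothesis DE : D = (-1) ^+ sgn * \prod_(q <- s) qstar q ^+ e q.
Hypothesis theta_mu4 : forall q, q \in s -> forall c, gmu4 (theta q c).
Hypothesis theta_mod :
  forall q, q \in s -> forall c, theta q (c %% q)%N = theta q c.
Hypothesis theta_eq0 : forall q, q \in s ->
  forall c, (theta q c == 0) = (q%:Z %| a ^+ 2 + c%:Z ^+ 2)%Z.
Hypothesis theta_rec : forall q, q \in s -> forall p c, prime p ->
  p%:Z = a ^+ 2 + c%:Z ^+ 2 -> (2 %| c)%N -> p != q ->
  qchar (p %/ 4) (sqrtN1 p a c) (qstar q)%:~R = theta q c.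
Hypothesis theta_sum : forall q, q \in s -> forall k, (0 < k)%N ->
  \sum_(c < q) theta q c ^+ k = residue_power_sum q k.

Local Notation M := (4 * \prod_(q <- s) q)%N.

Let s_prime : all prime s.
Proof. by apply: sub_all s_pr => q /andP[]. Qed.
Let s_odd : all odd s.
Proof. by apply: sub_all s_pr => q /andP[]. Qed.

Definition class_char (c : nat) : gaussint :=
  class4 sgn c * \prod_(q <- s) theta q c ^+ e q.

Lemma class_char_mu4 c : gmu4 (class_char c).
Proof.
rewrite /class_char gmu4M ?class4_mu4 // big_seq.
apply: (big_ind gmu4) => //; first exact: gmu4M.
by move=> q qs; apply/gmu4X/theta_mu4.
Qed.

Lemma class_char_neq0 c : (class_char c != 0)
  = ~~ odd c && all (fun q => ~~ (q%:Z %| a ^+ 2 + c%:Z ^+ 2)%Z) s.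
Proof.
rewrite /class_char gauss_mul_neq0; congr (_ && _).
  by rewrite /class4; case: (odd c) => //; case: (_ && _).
have : {subset s <= s} by [].
elim: {1 3 4}s => [|q r IH] rs; first by rewrite big_nil.
rewrite big_cons gauss_mul_neq0 gauss_exp_neq0 // IH; last first.
  by move=> l lr; apply: rs; rewrite inE lr orbT.
by rewrite /= theta_eq0 // rs ?mem_head.
Qed.

Lemma dvdn_M q : q \in s -> (q %| M)%N.
Proof.
by move=> qs; apply: dvdn_mull; rewrite prime_dvd_prod_primes // (allP s_prime).
Qed.

Lemma class_char_mod c : class_char (c %% M) = class_char c.
Proof.
rewrite /class_char -class4_mod modn_dvdm ?dvdn_mulr // class4_mod; congr (_ * _).
apply: eq_big_seq => q qs; congr (_ ^+ _).
by rewrite -theta_mod // modn_dvdm ?dvdn_M // theta_mod.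
Qed.

Lemma class_char_coprime c :
  (class_char c != 0) = coprime M (absz (a ^+ 2 + c%:Z ^+ 2)).
Proof.
rewrite class_char_neq0 coprimeMl; congr (_ && _).
  rewrite -[4%N]/(2 ^ 2)%N coprime_pexpl // coprime2n.
  have [b ->] : exists b, a = 1 + 4 * b.
    by exists (a %/ 4)%Z; move: a1; clear; lia.
  have [k kE] : exists k, c = (odd c + 2 * k)%N.
    by exists c./2; rewrite mul2n odd_double_half.
  set o := odd c in kE *.
  have -> : (1 + 4 * b) ^+ 2 + c%:Z ^+ 2
    = 1 + o%:Z + 2 * (4 * b + 8 * b ^+ 2 + 2 * o%:Z * k%:Z + 2 * k%:Z ^+ 2).
    by rewrite kE PoszD PoszM; case: o {kE} => /=; ring.
  by move: (_ + _ + _ + _); case: o {kE} => u; clear; lia.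
have : forall r, all prime r -> all (fun q => ~~ (q%:Z %| a ^+ 2 + c%:Z ^+ 2)%Z) r
    = coprime (\prod_(q <- r) q) (absz (a ^+ 2 + c%:Z ^+ 2)); last exact.
elim=> [|q r IH] /=; first by rewrite big_nil coprime1n.
by case/andP=> q_pr /IH ->; rewrite big_cons coprimeMl (prime_coprime _ q_pr).
Qed.

Lemma prime_dvd_D p : prime p -> (p%:Z %| D)%Z = (p \in s).
Proof.
move=> p_pr; rewrite -(prime_dvd_prod_primes p_pr s_prime).
rewrite DE dvdzE abszMsign absz_nat.
elim: s => [|q r IH]; first by rewrite !big_nil.
rewrite !big_cons abszM !Euclid_dvdM // IH abszX Euclid_dvdX // e_gt0 andbT.
by congr (_ || _); rewrite /qstar; case: ifP => _; rewrite ?abszN.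
Qed.

Section AtPrime.
Variables (p x : nat).
Hypotheses (p_pr : prime p) (pE : p%:Z = a ^+ 2 + x%:Z ^+ 2).

Lemma dvd_2D_class_char : ~~ (p%:Z %| 2 * D)%Z = (class_char x != 0).
Proof.
rewrite class_char_coprime -pE absz_nat coprime_sym prime_coprime //.
rewrite !Euclid_dvdM // prime_dvd_prod_primes // dvdzE abszM Euclid_dvdM //.
rewrite -[(p %| `|D|)%N]/(p%:Z %| D)%Z prime_dvd_D //.
by rewrite -[4%N]/(2 ^ 2)%N Euclid_dvdX // andbT.
Qed.

Lemma class_char_frob : ~~ (p%:Z %| 2 * D)%Z ->
  (frob_trace D p = 2 * a <-> class_char x = 1) /\
  (frob_trace D p = 2 * - a <-> class_char x = -1).
Proof.
move=> p2D; have := p2D; rewrite dvd_2D_class_char class_char_neq0.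
case/andP=> x_even /allP pq.
have x2 : (2 %| x)%N by rewrite dvdn2.
have x2z : (2 %| x%:Z)%Z by [].
have Q := two_squares_quartic p_pr pE a1 x2z.
have pD : ~~ (p%:Z %| D)%Z by apply: contra p2D; apply: dvdz_mull.
suff <- : qchar (p %/ 4) (sqrtN1 p a x) D%:~R = class_char x.
  exact: frob_trace_eq.
rewrite DE rmorphM rmorph_prod rmorphXn rmorphN1 (qcharM Q) (qcharX Q).
congr (_ * _).
  (* chi (-1) = (-1) ^ (p %/ 4), and p %/ 4 has the parity of x / 2. *)
  rewrite (qcharN1 Q) /class4 (negPf x_even) -exprM.
  rewrite -(signr_odd gaussint (p %/ 4 * sgn)) oddM oddb.
  congr (_ ^+ (nat_of_bool _)); rewrite andbC; congr (_ && _).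
  have [b [k [[aE xE mE] _]]] := two_squares_mod4 p_pr pE a1 x2z.
  have kE : k = (x./2)%:Z by move: xE x_even; clear; lia.
  have [t tE] : exists t, x./2 = (odd x./2 + 2 * t)%N.
    by exists (x./2)./2; rewrite mul2n odd_double_half.
  have : (p %/ 4)%N%:Z = (odd x./2)%:Z
      + 2 * (b + 2 * b ^+ 2 + 2 * t%:Z ^+ 2 + 2 * t%:Z * (odd x./2)%:Z).
    by rewrite mE kE {1}tE PoszD PoszM; case: (odd _) => /=; ring.
  move: (p %/ 4)%N (odd _) (_ + _ + _ + _) => m o u; clear.
  by case: o; lia.
rewrite (big_morph _ (qcharM Q) (qchar1 _ _)); apply: eq_big_seq => q qs.
rewrite rmorphXn (qcharX Q) (theta_rec qs p_pr pE x2) //.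
by have := pq _ qs; apply: contraNneq => <-; rewrite pE.
Qed.

End AtPrime.

Lemma sum_class_char k : (0 < k)%N ->
  \sum_(c < M) class_char c ^+ k
    = (1 + (-1) ^+ (sgn * k)) * \prod_(q <- s) residue_power_sum q (e q * k).
Proof.
move=> k_gt0.
transitivity (\sum_(c < M) class4 sgn c ^+ k * \prod_(q <- s) theta q c ^+ (e q * k)).
  apply: eq_bigr => c _; rewrite /class_char exprMn -prodrXl.
  by congr (_ * _); apply: eq_bigr => q _; rewrite exprM.
rewrite (@sum_mod_primes 4 s (fun c => class4 sgn c ^+ k)
                        (fun q c => theta q c ^+ (e q * k))) //.
- congr (_ * _).
    rewrite !big_ord_recl big_ord0 /class4 /= !expr0n (gtn_eqF k_gt0).
    by rewrite andbF andbT expr0 expr1n -exprM !add0r addr0.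
  by apply: eq_big_seq => q qs; rewrite theta_sum // muln_gt0 e_gt0.
- apply/allP => q qs.
  by rewrite -[4%N]/(2 ^ 2)%N coprime_pexpl // coprime2n (allP s_odd).
- by move=> c; rewrite class4_mod.
by move=> q qs c; rewrite theta_mod.
Qed.

End ClassCharacter.

(** [(q.+1 %/ 4)] is even exactly when [q] is 1 or 7 modulo 8. *)
Lemma prod_sign_mod8 (r : seq nat) : all odd r ->
  \prod_(q <- r) - (-1) ^+ (q.+1 %/ 4)
    = (-1) ^+ (count_mod8 1 r + count_mod8 7 r) :> gaussint.
Proof.
rewrite /count_mod8; elim: r => [|q r IH] /=; first by rewrite big_nil.
case/andP=> q_odd /IH {}IH; rewrite big_cons IH addnACA [RHS]exprD; congr (_ * _).
rewrite -(signr_odd gaussint (q.+1 %/ 4)) -[RHS]signr_odd.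
have -> : odd (q.+1 %/ 4) = ~~ odd ((q %% 8 == 1) + (q %% 8 == 7))%N by move: q_odd; lia.
by case: (odd _).
Qed.

Section ClassCounts.
Variables (a D : int) (sgn : bool) (ps qs ls : seq nat).
Variable theta : nat -> nat -> gaussint.
Local Notation s := (ps ++ qs ++ ls).
Local Notation e := (prime_exponent ps qs).
Local Notation M := (4 * \prod_(q <- s) q)%N.
Hypothesis s_pr : all (fun p => prime p && odd p) s.
Hypothesis s_uniq : uniq s.
Hypothesis theta_mu4 : forall q, q \in s -> forall c, gmu4 (theta q c).
Hypothesis theta_mod :
  forall q, q \in s -> forall c, theta q (c %% q)%N = theta q c.
Hypothesis theta_sum : forall q, q \in s -> forall k, (0 < k)%N ->
  \sum_(c < q) theta q c ^+ k = residue_power_sum q k.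

Local Notation cchar := (class_char sgn s e theta).
Local Notation T r := (\prod_(q <- r) tau_prime q)%N.

Definition class_sign : nat :=
  count_mod8 1 ps + count_mod8 7 ps + size qs + count_mod8 1 ls + count_mod8 7 ls.

Let s_prime : all prime s.
Proof. by apply: sub_all s_pr => q /andP[]. Qed.
Let s_odd : all odd s.
Proof. by apply: sub_all s_pr => q /andP[]. Qed.

Lemma sum_class_char_split k : (0 < k)%N ->
  \sum_(c < M) cchar c ^+ k
    = (1 + (-1) ^+ (sgn * k)) *
      (\prod_(q <- ps) residue_power_sum q (1 * k)
       * (\prod_(q <- qs) residue_power_sum q (2 * k)
          * \prod_(q <- ls) residue_power_sum q (3 * k))).
Proof.
move=> k_gt0.
rewrite (sum_class_char sgn s_pr s_uniq (prime_exponent_gt0 ps qs) theta_mod) //.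
congr (_ * _).
exact: (big_prime_exponent s_uniq *%R (fun i q => residue_power_sum q (i * k))).
Qed.

Lemma prod_residue_power_sum_4 r k : {subset r <= s} ->
  \prod_(q <- r) residue_power_sum q (4 * k) = (T r)%:R.
Proof.
move=> rs; rewrite natr_prod; apply: eq_big_seq => q /rs qs'.
by have /andP[q_pr q_odd] := allP s_pr _ qs'; apply: residue_power_sum_4.
Qed.

Lemma prod_residue_power_sum_2 (r : seq nat) k :
  \prod_(q <- r) residue_power_sum q (4 * k + 2) = (-1) ^+ size r.
Proof.
elim: r => [|q r IH]; first by rewrite big_nil.
by rewrite big_cons IH residue_power_sum_2 exprS.
Qed.

Lemma prod_residue_power_sum_odd (r : seq nat) k : all odd r -> odd k ->
  \prod_(q <- r) residue_power_sum q k
    = (-1) ^+ (count_mod8 1 r + count_mod8 7 r).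
Proof.
move=> r_odd k_odd; rewrite -prod_sign_mod8 //.
by apply: eq_bigr => q _; apply: residue_power_sum_odd.
Qed.

Lemma sum_class_char4 : \sum_(c < M) cchar c ^+ 4 = 2 * (T s)%:R.
Proof.
have sgn4 : (-1) ^+ (sgn * 4) = 1 :> gaussint by exact: (sign_even sgn 2).
rewrite sum_class_char_split // sgn4; congr (_ * _).
rewrite !big_cat !natrM /=; congr (_ * (_ * _)).
- by apply: (prod_residue_power_sum_4 1) => q qr; rewrite mem_cat qr.
- by apply: (prod_residue_power_sum_4 2) => q qr; rewrite !mem_cat qr orbT.
by apply: (prod_residue_power_sum_4 3) => q qr; rewrite !mem_cat qr !orbT.
Qed.

Lemma sum_class_char2 : \sum_(c < M) cchar c ^+ 2
  = 2 * ((-1) ^+ (size ps + size ls) * (T qs)%:R).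
Proof.
have sgn2 : (-1) ^+ (sgn * 2) = 1 :> gaussint by exact: (sign_even sgn 1).
rewrite sum_class_char_split // sgn2; congr (_ * _).
rewrite exprD -mulrA [X in _ = _ * X]mulrC; congr (_ * (_ * _)).
- exact: (prod_residue_power_sum_2 ps 0).
- by apply: (prod_residue_power_sum_4 1) => q qr; rewrite !mem_cat qr orbT.
exact: (prod_residue_power_sum_2 ls 1).
Qed.

Lemma sum_class_char_odd k : odd k ->
  \sum_(c < M) cchar c ^+ k = (1 + (-1) ^+ sgn) * (-1) ^+ class_sign.
Proof.
move=> k_odd; have k_gt0 : (0 < k)%N by case: k k_odd.
have [ps_odd _ ls_odd] : [/\ all odd ps, all odd qs & all odd ls].
  by move: s_odd; rewrite !all_cat => /and3P[].
rewrite sum_class_char_split //; congr (_ * _).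
  by rewrite -signr_odd oddM k_odd andbT signr_odd.
have [l lE] : exists l, (2 * k = 4 * l + 2)%N by exists (k./2); lia.
rewrite lE prod_residue_power_sum_2 !prod_residue_power_sum_odd ?oddM ?k_odd //.
by rewrite -!exprD /class_sign !addnA.
Qed.

End ClassCounts.

(** * The Hardy-Littlewood constant *)

Local Open Scope classical_set_scope.

Section HardyLittlewood.
Variable R : realType.
Implicit Types u v : nat -> R.

(** The limit of a divergent sequence is the default value 0. *)
Lemma lim_neq0_cvg u : lim (u @ \oo) != 0 -> u @ \oo --> lim (u @ \oo).
Proof.
move=> u0; apply: contrapT => ncvg; case/eqP: u0.
by apply: getPN => l ul; apply: ncvg; rewrite (cvg_lim _ ul).
Qed.

Lemma lim_neq0_scale u v (C : R) : C != 0 -> (\forall n \near \oo, u n = C * v n) ->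
  lim (v @ \oo) != 0 -> lim (u @ \oo) != 0.
Proof.
move=> C0 uv v0; have vc := lim_neq0_cvg v0.
have uc : u @ \oo --> C * lim (v @ \oo).
  have uv' : \forall n \near \oo, C * v n = u n by near=> n; apply/esym; near: n.
  by apply: (cvg_trans (near_eq_cvg uv')); apply: cvgMl_tmp.
by rewrite (cvg_lim _ uc) // mulf_neq0.
Unshelve. all: by end_near. Qed.

Definition hl_scale (n : nat) : R := Num.sqrt n%:R / ln n%:R.

Lemma hl_scale_gt0 n : (1 < n)%N -> 0 < hl_scale n.
Proof. by move=> n1; rewrite divr_gt0 ?sqrtr_gt0 ?ln_gt0 ?ltr1n ?ltr0n // ltnW. Qed.

(** With [y] the fourth root of [n], this is [ln y <= y]. *)
Lemma hl_scaleV_le n : (1 < n)%N -> (hl_scale n)^-1 <= 4 / Num.sqrt (Num.sqrt n%:R).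
Proof.
move=> n1; set y := Num.sqrt (Num.sqrt _).
have n0 : 0 < n%:R :> R by rewrite ltr0n ltnW.
have y0 : 0 < y by rewrite !sqrtr_gt0.
have yE : Num.sqrt n%:R = y ^+ 2 :> R by rewrite sqr_sqrtr ?sqrtr_ge0.
have nE : n%:R = y ^+ 4 :> R.
  by rewrite -[4%N]/(2 * 2)%N exprM -yE sqr_sqrtr // ltW.
rewrite /hl_scale yE nE lnXn // invf_div ler_pdivrMr ?exprn_gt0 //.
have -> : 4 / y * y ^+ 2 = y *+ 4 by field; rewrite gt_eqF.
by rewrite lerMn2r ltW // ln_sublinear.
Qed.

Lemma hl_scaleV_cvg0 : (hl_scale n)^-1 @[n --> \oo] --> (0 : R).
Proof.
apply/cvgrPdist_lt => e e0; near=> n.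
have n1 : (1 < n)%N by near: n; apply: nbhs_infty_gt.
rewrite sub0r normrN ger0_norm ?invr_ge0 ?ltW ?hl_scale_gt0 //.
apply: le_lt_trans (hl_scaleV_le n1) _.
have y0 : 0 < Num.sqrt (Num.sqrt n%:R) :> R by rewrite !sqrtr_gt0 ltr0n ltnW.
rewrite ltr_pdivrMr // mulrC -ltr_pdivrMr //.
have -> : 4 / e = Num.sqrt (Num.sqrt ((4 / e) ^+ 4)) :> R.
  rewrite -[4%N]/(2 * 2)%N exprM sqrtr_sqr ger0_norm ?sqr_ge0 //.
  by rewrite sqrtr_sqr ger0_norm // divr_ge0 // ltW.
rewrite !ltr_sqrt ?sqrtr_gt0 ?ltr0n ?(ltnW n1) //.
by near: n; apply: nbhs_infty_gtr.
Unshelve. all: by end_near. Qed.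

Lemma equiv_ratio_cvg (f : nat -> R) (k : R) :
  f ~_\oo (fun n => k * (Num.sqrt n%:R / ln n%:R)) ->
  f n / hl_scale n @[n --> \oo] --> k.
Proof.
move=> /eqaddoP fk; apply/cvgrPdist_lt => e e0; near=> n.
have n1 : (1 < n)%N by near: n; apply: nbhs_infty_gt.
have h0 := hl_scale_gt0 n1.
have k1 : 0 < `|k| + 1 by rewrite ltr_wpDl.
have : `|f n - k * hl_scale n| <= e / (`|k| + 1) * `|k * hl_scale n|.
  by near: n; apply: fk; rewrite divr_gt0.
move=> fn; have -> : k - f n / hl_scale n = - ((f n - k * hl_scale n) / hl_scale n).
  by field; rewrite gt_eqF.
rewrite normrN normrM normfV (gtr0_norm h0) ltr_pdivrMr //; apply: le_lt_trans fn _.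
rewrite normrM (gtr0_norm h0) mulrA ltr_pM2r // mulrAC ltr_pdivrMr //.
by rewrite ltr_pM2l // ltrDl.
Unshelve. all: by end_near. Qed.

Definition hl_factor (d : int) (p : nat) : R := 1 - (legendre d p)%:~R / (p%:R - 1).

Lemma hl_factor_neq0 d p : (2 < p)%N -> hl_factor d p != 0.
Proof.
move=> p2; have p1 : 0 < p%:R - 1 :> R by rewrite subr_gt0 ltr1n; lia.
have p3 : 3 <= p%:R :> R by rewrite ler_nat.
rewrite /hl_factor subr_eq0 eq_sym -(inj_eq (mulIf (lt0r_neq0 p1))) divfK ?lt0r_neq0 //.
rewrite mul1r; apply/eqP; rewrite /legendre.
by case: ifP => _; [|case: ifP => _]; rewrite ?rmorphN /= => h; lra.
Qed.

(** A class [c] modulo [M] is represented by the polynomial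
    [(M y + c) ^ 2 + a ^ 2], of discriminant [- 4 (M a) ^ 2]. *)
Lemma discr_class (M a c : int) :
  discr (M ^+ 2) (2 * M * c) (c ^+ 2 + a ^+ 2) = - 4 * (M * a) ^+ 2.
Proof. by rewrite /discr; ring. Qed.

Lemma legendre_sq_mul (d u : int) p : prime p -> ~~ (p%:Z %| u)%Z ->
  legendre (d * u ^+ 2) p = legendre d p.
Proof.
move=> p_pr pu; rewrite /legendre.
have pD (n : int) : (n%:~R == 0 :> 'F_p) = (p%:Z %| n)%Z.
  by rewrite -(dvdz_pcharf (pchar_Fp p_pr)).
have u0 : u%:~R != 0 :> 'F_p by rewrite pD.
rewrite -!pD rmorphM rmorphXn mulf_eq0 expf_eq0 /= (negPf u0) orbF.
case: ifP => // _; congr (if _ then _ else _).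
apply/existsP/existsP => -[x /eqP xE].
  by exists (x / u%:~R); rewrite expr_div_n xE mulfK // expf_neq0.
by exists (x * u%:~R); rewrite exprMn xE.
Qed.

(** With constant 0 the count would vanish for large [n], but it includes the prime
    [2 = 1 ^ 2 + 1]. *)
Lemma hl_constant_1_neq0 : hardy_littlewood R -> hl_constant R 1 0 1 != 0.
Proof.
move=> HL; apply/eqP => k0.
have : ~ exists d : int, discr 1 0 1 = d ^+ 2.
  by case=> d; rewrite /discr => h; have := sqr_ge0 d; rewrite -h.
move/(HL 1 0 1 isT erefl isT)/eqaddoP/(_ 1 ltr01); rewrite k0 => h.
near \oo => n.
have n2 : (2 < n)%N by near: n; apply: nbhs_infty_gt.
have : `|(count_below (quadratic_primes 1 0 1) n)%:R - 0 * hl_scale n|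
    <= 1 * `|0 * hl_scale n| by near: n.
rewrite mul0r normr0 mulr0 subr0 normr_le0 pnatr_eq0 => /eqP/card0_eq/(_ (Ordinal n2)).
by rewrite !inE /= mem_set //; split=> //; exists 1%N.
Unshelve. all: by end_near. Qed.

Definition hl_partial (P : pred nat) (d : int) (n : nat) : R :=
  \prod_(0 <= p < n | [&& prime p, (2 < p)%N & P p]) hl_factor d p.

(** The two Euler products have the same factor at each prime not dividing [M a]. *)
Lemma hl_partial_eventually (M a : int) : M * a != 0 ->
  exists2 C : R, C != 0 & \forall n \near \oo,
    hl_partial (fun p => ~~ (p%:Z %| M ^+ 2)%Z) (- 4 * (M * a) ^+ 2) n
    = C * hl_partial (fun p => ~~ (p%:Z %| 1)%Z) (- 4) n.
Proof.
move=> Ma0; pose h (p : nat) : R := if (p%:Z %| M * a)%Z then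
  (if (p%:Z %| M ^+ 2)%Z then 1 else hl_factor (- 4 * (M * a) ^+ 2) p)
    / hl_factor (- 4) p else 1.
pose H n := \prod_(0 <= p < n | prime p && (2 < p)%N) h p.
exists (H (absz (M * a)).+1).
  rewrite /H; apply: (big_ind (fun x => x != 0)) => [|x y x0 y0|p /andP[_ p2]].
  - exact: oner_neq0.
  - exact: mulf_neq0.
  rewrite /h; case: ifP => _; last exact: oner_neq0.
  rewrite mulf_neq0 ?invr_eq0 ?hl_factor_neq0 //.
  by case: ifP => _; [exact: oner_neq0 | exact: hl_factor_neq0].
near=> n; have nMa : ((absz (M * a)%R).+1 <= n)%N by near: n; apply: nbhs_infty_ge.
have -> : H (absz (M * a)).+1 = H n.
  rewrite /H [RHS](big_cat_nat _ nMa) //= [X in _ = _ * X]big1_seq ?mulr1 //.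
  move=> p; rewrite mem_index_iota => /andP[_ /andP[pge _]].
  rewrite /h; case: ifP => // /dvdzP[k kE].
  have : (absz (M * a)%R = absz k * p)%N by rewrite kE abszM absz_nat.
  have : (0 < absz k)%N.
    by rewrite absz_gt0; apply: contraNneq Ma0 => k0; rewrite kE k0 mul0r.
  by move: pge; move: (absz (M * a)) (absz k) => x y; clear; nia.
rewrite /hl_partial /H.
have split_cond (P : pred nat) (F : nat -> R) :
    \prod_(0 <= p < n | [&& prime p, (2 < p)%N & P p]) F p
    = \prod_(0 <= p < n | prime p && (2 < p)%N) (if P p then F p else 1).
  by rewrite -big_mkcondr; apply: eq_bigl => p; rewrite andbA.
rewrite !split_cond -big_split /=; apply: eq_bigr => p /andP[p_pr p2].
have -> : (p%:Z %| 1)%Z = false by apply/negbTE; rewrite dvdz1 absz_nat; lia.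
rewrite /h; case: (boolP (p%:Z %| M * a)%Z) => pMa /=.
  by rewrite divfK ?hl_factor_neq0 //; case: (_ %| _)%Z.
have -> : (p%:Z %| M ^+ 2)%Z = false.
  apply/negbTE; apply: contra pMa => pM; apply: dvdz_mulr; move: pM.
  by rewrite !dvdzE abszX Euclid_dvdX //= andbT.
by rewrite mul1r /hl_factor legendre_sq_mul.
Unshelve. all: by end_near. Qed.

(** The discriminant does not involve [c], and the other factors see [c] only through
    [2 M c], which 2 and the primes dividing [M] always divide. *)
Lemma hl_constant_class (M : nat) (a : int) : hardy_littlewood R ->
    (0 < M)%N -> (2 %| M)%N -> a != 0 ->
  exists2 k : R, k != 0 & forall c : nat,
    hl_constant R (M%:Z ^+ 2) (2 * M%:Z * c%:Z) (c%:Z ^+ 2 + a ^+ 2) = k.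
Proof.
move=> HL M0 M2 a0; have Ma0 : M%:Z * a != 0 by rewrite mulf_neq0 //; lia.
exists (hl_constant R (M%:Z ^+ 2) (2 * M%:Z * 0%:Z) (0%:Z ^+ 2 + a ^+ 2)).
  rewrite /hl_constant discr_class !mulf_neq0 //.
  - by rewrite intr_eq0 gcdz_eq0.
  - by rewrite invr_eq0 gt_eqF // sqrtr_gt0 ltr0z exprn_gt0 //; lia.
  - apply: (big_ind (fun x => x != 0)) => [|x y|p /andP[p2 _]].
    + exact: oner_neq0.
    + exact: mulf_neq0.
    have p1 : 0 < p%:R - 1 :> R by rewrite subr_gt0 ltr1n; lia.
    by rewrite mulf_neq0 ?invr_eq0 ?(gt_eqF p1) // pnatr_eq0; lia.
  have [C C0 ev] := hl_partial_eventually Ma0.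
  apply: (lim_neq0_scale C0 ev).
  have := hl_constant_1_neq0 HL; rewrite /hl_constant => /eqP k0.
  by apply/eqP => l0; apply: k0; rewrite [X in _ * X]l0 mulr0.
move=> c; rewrite /hl_constant !discr_class; congr (_ * _); congr (_ / _ * _).
  have [m ->] : exists m : int, M%:Z = 2 * m by exists (M %/ 2)%N%:Z; lia.
  have g2 (k : int) : gcdz 2 (2 * k) = 2 by rewrite gcdzMr.
  rewrite (_ : _ + _ = 2 * (2 * m ^+ 2 + 2 * m * c%:Z)); last by ring.
  by rewrite [X in _ = (gcdz _ X)%:~R](_ : _ = 2 * (2 * m ^+ 2)) ?g2 //; ring.
rewrite big_seq_cond [RHS]big_seq_cond; apply: eq_bigl => p.
rewrite abszX absz_nat mem_primes; case: (boolP (prime p)) => //= p_pr.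
rewrite Euclid_dvdX // andbT expn_gt0 M0 /=.
case: (boolP (p %| M)%N) => //= pM.
have h (u : int) : (p%:Z %| 2 * M%:Z * u)%Z by apply/dvdz_mulr/dvdz_mull.
by rewrite !h.
Qed.


(** * Densities from residue classes *)

Section Density.
Variables (M : nat) (a : int).
Hypotheses (HL : hardy_littlewood R) (M_gt0 : (0 < M)%N) (M_even : (2 %| M)%N).
Hypothesis a_neq0 : a != 0.

Definition class_primes (c : nat) : set nat :=
  quadratic_primes (M%:Z ^+ 2) (2 * M%:Z * c%:Z) (c%:Z ^+ 2 + a ^+ 2).

Definition admissible (c : nat) : bool := coprime M (absz (a ^+ 2 + c%:Z ^+ 2)).

Lemma admissible_mod c : admissible (c %% M) = admissible c.
Proof.
suff : gcdz M%:Z (a ^+ 2 + (c %% M)%N%:Z ^+ 2) = gcdz M%:Z (a ^+ 2 + c%:Z ^+ 2).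
  by rewrite /gcdz => -[e]; rewrite /admissible /coprime e.
have -> : c%:Z = (c %/ M)%N%:Z * M%:Z + (c %% M)%N%:Z.
  by rewrite -PoszM -PoszD -divn_eq.
move: (c %/ M)%N%:Z (c %% M)%N%:Z M%:Z => k r m.
have -> : a ^+ 2 + (k * m + r) ^+ 2 = (k * (k * m + 2 * r)) * m + (a ^+ 2 + r ^+ 2).
  by ring.
by rewrite gcdzMDl.
Qed.

Lemma class_primesP c k : (c < M)%N -> class_primes c k <->
  prime k /\ exists2 x : nat, (x %% M = c)%N & k%:Z = a ^+ 2 + x%:Z ^+ 2.
Proof.
move=> cM; split=> -[k_pr].
  case=> y kE; split=> //; exists (M * y + c)%N.
    by rewrite mulnC modnMDl modn_small.
  by rewrite kE PoszD PoszM; ring.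
case=> x xc kE; split=> //; exists (x %/ M)%N.
have xE : x%:Z = (x %/ M)%N%:Z * M%:Z + c%:Z by rewrite -PoszM -PoszD -xc -divn_eq.
by rewrite kE xE; ring.
Qed.

Lemma count_class_cvg : exists2 k : R, k != 0 & forall c, admissible c ->
  (count_below (class_primes c) n)%:R / hl_scale n @[n --> \oo] --> k.
Proof.
have [k k0 kE] := hl_constant_class HL M_gt0 M_even a_neq0; exists k => // c cM.
apply: equiv_ratio_cvg; rewrite -(kE c).
have M0 : 0 < M%:Z ^+ 2 by rewrite exprn_gt0.
apply: HL => //.
- rewrite /gcdz; congr Posz; apply/eqP; apply: (coprime_dvdl (dvdn_gcdl _ _)).
  by rewrite abszX absz_nat coprimeXl // addrC.
- rewrite negb_and; apply/orP; right.
  apply/negP => c2; have : (2 %| gcdn M (absz (a ^+ 2 + c%:Z ^+ 2)%R))%N.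
    by rewrite dvdn_gcd M_even addrC.
  by rewrite (eqP cM).
case=> d; rewrite discr_class => dE; have := sqr_ge0 d; rewrite -dE leNgt => /negP; apply.
rewrite mulNr oppr_lt0 mulr_gt0 // exprn_even_gt0 //= mulf_neq0 //; lia.
Qed.

Lemma count_belowE (A : set nat) n : count_below A n = (\sum_(k < n) ((k : nat) \in A))%N.
Proof.
rewrite /count_below -sum1_card big_mkcond.
by apply: eq_bigr => k _; rewrite inE.
Qed.

Lemma count_below_split (A B : set nat) n :
  count_below A n = (count_below (A `&` B) n + count_below (A `&` ~` B) n)%N.
Proof.
rewrite !count_belowE -big_split; apply: eq_bigr => k _ /=.
by rewrite !in_setI in_setC; case: (_ \in A); case: (_ \in B).
Qed.

(** A prime [p = a ^ 2 + x ^ 2] determines [x], hence lies in one class. *)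
Lemma count_below_classes (P : set nat) (G : pred nat) n :
    (forall p x : nat, prime p -> p%:Z = a ^+ 2 + x%:Z ^+ 2 -> P p <-> G (x %% M)%N) ->
  count_below (Qset a `&` P) n
    = (\sum_(c < M | G c) count_below (class_primes c) n)%N.
Proof.
move=> PG; rewrite count_belowE; under [RHS]eq_bigr do rewrite count_belowE.
rewrite exchange_big; apply: eq_bigr => k _ /=; move: (k : nat) => {n}k.
have [[k_pr [x kE]]|nQ] := pselect (Qset a k); last first.
  rewrite memNset => [|[]//]; rewrite big1 // => c _; rewrite memNset //.
  case/(class_primesP _ (ltn_ord c)) => k_pr [x _ kE].
  by apply: nQ; split=> //; exists x%:Z.
pose y := absz x; have {}kE : k%:Z = a ^+ 2 + y%:Z ^+ 2 by rewrite kE /y; lia.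
pose c0 := Ordinal (ltn_pmod y M_gt0).
have in_class (c : 'I_M) : (k \in class_primes c) = (c == c0).
  apply/idP/eqP => [|->]; rewrite inE; last first.
    by apply/class_primesP; rewrite ?ltn_pmod //; split=> //; exists y.
  case/(class_primesP _ (ltn_ord c)) => _ [z zc kz]; apply: val_inj => /=.
  rewrite -zc; congr (_ %% _)%N; move: kz; rewrite kE => /addrI/eqP.
  by rewrite eqf_sqr => /orP[]/eqP; clear; lia.
under eq_bigr do rewrite in_class.
have -> : (k \in Qset a `&` P) = G c0.
  apply/idP/idP; rewrite inE; first by case=> _ /(PG _ _ k_pr kE).
  by move=> Gc; split; [split=> //; exists y%:Z | apply/(PG _ _ k_pr kE)].
case: (boolP (G c0)) => Gc.
  rewrite (bigD1 c0) //= eqxx big1 // => c /andP[_ /negPf->] //.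
by rewrite big1 // => c Gc'; case: eqP => // cc; move: Gc; rewrite -cc Gc'.
Qed.

Lemma cvg_sum_classes (G : pred nat) (k : R) :
    (forall c, G c ->
       (count_below (class_primes c) n)%:R / hl_scale n @[n --> \oo] --> k) ->
  (\sum_(c < M | G c) count_below (class_primes c) n)%N%:R / hl_scale n @[n --> \oo]
    --> #|[pred c : 'I_M | G c]|%:R * k.
Proof.
move=> Gk; rewrite -sum1_card natr_sum mulr_suml.
rewrite (eq_bigl (fun c : 'I_M => G c)) => [|c]; last by rewrite inE.
under eq_fun do rewrite natr_sum mulr_suml.
suff key (r : seq 'I_M) :
    \sum_(c <- r | G c) ((count_below (class_primes c) n)%:R / hl_scale n) @[n --> \oo]
      --> \sum_(c <- r | G c) (1%:R * k) by exact: key.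
elim: r => [|c r IH].
  under eq_fun do rewrite big_nil.
  by rewrite big_nil; apply: cvg_cst.
under eq_fun do rewrite big_cons.
rewrite big_cons; case: (boolP (G c)) => // Gc.
by apply: cvgD => //; rewrite mul1r; apply: Gk.
Qed.

(** All primes [a ^ 2 + x ^ 2] lie in the admissible classes, except divisors of [M],
    and the counts in these classes are asymptotic to one multiple of [hl_scale]. *)
Theorem density_of_classes (P : set nat) (G : pred nat) :
    (forall c, G c -> admissible c) ->
    (forall p x : nat, prime p -> p%:Z = a ^+ 2 + x%:Z ^+ 2 -> P p <-> G (x %% M)%N) ->
    (0 < #|[pred c : 'I_M | admissible c]|)%N ->
  (count_below (Qset a `&` P) N.+1)%:R / (count_below (Qset a) N.+1)%:R @[N --> \oo]
    --> (#|[pred c : 'I_M | G c]|%:R / #|[pred c : 'I_M | admissible c]|%:R : R).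
Proof.
move=> Gadm PG adm_gt0.
have [k k0 kE] := count_class_cvg.
pose B := [set p | ~~ (p %| M)%N].
have good_cvg := cvg_sum_classes (fun c Gc => kE c (Gadm c Gc)).
have adm_cvg := cvg_sum_classes kE.
have goodE n : count_below (Qset a `&` P) n
    = (\sum_(c < M | G c) count_below (class_primes c) n)%N.
  exact: count_below_classes.
have totE n : count_below (Qset a) n
    = ((\sum_(c < M | admissible c) count_below (class_primes c) n)
       + count_below (Qset a `&` ~` B) n)%N.
  rewrite (count_below_split _ B); congr (_ + _)%N; apply: count_below_classes.
  move=> p x p_pr pE; rewrite admissible_mod /admissible -pE absz_nat.
  by rewrite coprime_sym prime_coprime.
have rest n : (count_below (Qset a `&` ~` B) n <= M.+1)%N.
  rewrite /count_below -[leqRHS](size_iota 0) cardE.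
  rewrite -(size_map (fun k : 'I_n => k : nat)); apply: uniq_leq_size.
    by rewrite map_inj_uniq ?enum_uniq //; apply: val_inj.
  move=> _ /mapP[l lin ->]; rewrite mem_iota ltnS /=; move: lin.
  by rewrite mem_enum => /set_mem[_ /negP]; rewrite negbK; apply: dvdn_leq.
have rest_cvg :
    (count_below (Qset a `&` ~` B) n)%:R / hl_scale n @[n --> \oo] --> (0 : R).
  have M1_cvg : M.+1%:R * (hl_scale n)^-1 @[n --> \oo] --> (0 : R).
    by rewrite -[X in _ --> X](mulr0 M.+1%:R); apply: cvgMl_tmp; apply: hl_scaleV_cvg0.
  apply: (squeeze_cvgr _ (cvg_cst (0 : R)) M1_cvg); near=> n.
  have n1 : (1 < n)%N by near: n; apply: nbhs_infty_gt.
  have h0 := hl_scale_gt0 n1.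
  apply/andP; split; first by rewrite mulr_ge0 // invr_ge0 ltW.
  by rewrite ler_wpM2r ?invr_ge0 ?(ltW h0) // ler_nat.
have tot_cvg : (count_below (Qset a) n)%:R / hl_scale n @[n --> \oo]
    --> #|[pred c : 'I_M | admissible c]|%:R * k.
  have := cvgD adm_cvg rest_cvg; rewrite addr0 => tot.
  have ev : \forall n \near \oo,
      (\sum_(c < M | admissible c) count_below (class_primes c) n)%N%:R / hl_scale n
        + (count_below (Qset a `&` ~` B) n)%:R / hl_scale n
      = (count_below (Qset a) n)%:R / hl_scale n.
    by near=> n; rewrite totE natrD mulrDl.
  exact: cvg_trans (near_eq_cvg ev) (tot _).
have tot0 : #|[pred c : 'I_M | admissible c]|%:R * k != 0.
  by rewrite mulf_neq0 // pnatr_eq0 -lt0n.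
rewrite (cvg_shiftS (fun n =>
  (count_below (Qset a `&` P) n)%:R / (count_below (Qset a) n)%:R : R^o)).
have -> : #|[pred c : 'I_M | G c]|%:R / #|[pred c : 'I_M | admissible c]|%:R
  = (#|[pred c : 'I_M | G c]|%:R * k)
    * (#|[pred c : 'I_M | admissible c]|%:R * k)^-1 :> R.
  by rewrite invfM mulrACA divff // mulr1.
have ev : \forall n \near \oo,
    (\sum_(c < M | G c) count_below (class_primes c) n)%N%:R / hl_scale n
      * ((count_below (Qset a) n)%:R / hl_scale n)^-1
    = (count_below (Qset a `&` P) n)%:R / (count_below (Qset a) n)%:R.
  near=> n; have n1 : (1 < n)%N by near: n; apply: nbhs_infty_gt.
  have h0 := hl_scale_gt0 n1; rewrite -goodE.
  move: (hl_scale n) h0 => h h0.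
  by rewrite invf_div mulrA divfK // gt_eqF.
apply: cvg_trans (near_eq_cvg ev) _; apply: cvgM good_cvg _.
exact: cvgV.
Unshelve. all: by end_near. Qed.

End Density.

End HardyLittlewood.

(** * The densities *)

(** The factor [1 + (-1) ^+ sgn] is the sum of [class4] over the two even classes
    modulo 4; it kills the odd power sums when [D] is 3 modulo 4. *)
Lemma dens_of_sign (R : realType) (HL : hardy_littlewood R) (a D : int)
    (sgn : bool) (ps qs ls : seq nat) :
    (a = 1 %[mod 4])%Z ->
    all (fun p => prime p && odd p) (ps ++ qs ++ ls) ->
    uniq (ps ++ qs ++ ls) -> coprimez D a ->
    D = (-1) ^+ sgn * \prod_(q <- ps ++ qs ++ ls) qstar q ^+ prime_exponent ps qs q ->
  let A : R := (-1) ^+ (size ps + size ls) / (tau (\prod_(p <- ps ++ ls) p))%:R in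
  let B : R := (1 + (-1) ^+ sgn) * (-1) ^+ class_sign ps qs ls
               / (tau (\prod_(p <- ps ++ qs ++ ls) p))%:R in
  dens_is D a (1 / 4 * (1 + A + B)) /\ dens_is D (- a) (1 / 4 * (1 + A - B)).
Proof.
move=> a1 s_pr s_uniq Da DE A B; set s := ps ++ qs ++ ls in s_pr s_uniq DE B *.
set e := prime_exponent ps qs in DE.
have e_gt0 := prime_exponent_gt0 ps qs.
have a0 : a != 0 by apply: contra_eqN a1 => /eqP->.
have s_prime : all prime s by apply: sub_all s_pr => q /andP[].
have residue_char q : exists th : nat -> gaussint, q \in s ->
  [/\ forall c, gmu4 (th c),
      forall c, th (c %% q)%N = th c,
      forall c, (th c == 0) = (q%:Z %| a ^+ 2 + c%:Z ^+ 2)%Z,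
      forall p c, prime p -> p%:Z = a ^+ 2 + c%:Z ^+ 2 -> (2 %| c)%N -> p != q ->
        qchar (p %/ 4) (sqrtN1 p a c) (qstar q)%:~R = th c
    & forall k, (0 < k)%N -> \sum_(c < q) th c ^+ k = residue_power_sum q k].
  case: (boolP (q \in s)) => [qs'|_]; last by exists (fun=> 0).
  have /andP[q_pr q_odd] := allP s_pr _ qs'.
  have qa : ~~ (q%:Z %| a)%Z.
    apply/negP => qa; have qD : (q%:Z %| D)%Z by rewrite (prime_dvd_D s_pr e_gt0 DE).
    have : (q%:Z %| gcdz D a)%Z by rewrite dvdz_gcd qD.
    by rewrite (eqP Da) dvdz1 absz_nat gtn_eqF // prime_gt1.
  by have [th thP] := exists_residue_char q_pr q_odd qa a1; exists th => _.
have [theta thetaP] := choice residue_char.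
have theta_mu4 q qs' := let: And5 h _ _ _ _ := thetaP q qs' in h.
have theta_mod q qs' := let: And5 _ h _ _ _ := thetaP q qs' in h.
have theta_eq0 q qs' := let: And5 _ _ h _ _ := thetaP q qs' in h.
have theta_rec q qs' := let: And5 _ _ _ h _ := thetaP q qs' in h.
have theta_sum q qs' := let: And5 _ _ _ _ h := thetaP q qs' in h.
pose M := (4 * \prod_(q <- s) q)%N; pose chr := class_char sgn s e theta.
have M_gt0 : (0 < M)%N by rewrite muln_gt0 prod_primes_gt0.
have M_even : (2 %| M)%N by apply: dvdn_mulr.
have chr_mu4 c : gmu4 (chr c) by apply: class_char_mu4.
have chr_mod c : chr (c %% M)%N = chr c by exact: (class_char_mod sgn e s_pr theta_mod).
have chr_adm c : (chr c != 0) = admissible M a c.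
  exact: (class_char_coprime sgn s_pr e_gt0 a1 theta_eq0).
pose T r : R := (\prod_(q <- r) tau_prime q)%N%:R.
have T_gt0 r : all (fun p => prime p && odd p) r -> 0 < T r.
  rewrite /T ltr0n; elim: r => [|q r IH] /=; first by rewrite big_nil.
  case/andP=> /andP[/prime_gt1 q1 q_odd] /IH; rewrite big_cons muln_gt0 => ->.
  by rewrite andbT /tau_prime; case: ifP => _; lia.
have [ps_pr qs_pr ls_pr] : [/\ all (fun p => prime p && odd p) ps,
    all (fun p => prime p && odd p) qs & all (fun p => prime p && odd p) ls].
  by move: s_pr; rewrite !all_cat => /and3P[].
have [Tps Tqs Tls] := And3 (T_gt0 _ ps_pr) (T_gt0 _ qs_pr) (T_gt0 _ ls_pr).
have Ts : T s = T ps * T qs * T ls by rewrite /T !big_cat !natrM mulrA.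
have tau_s : (tau (\prod_(p <- s) p))%:R = T s by rewrite tau_prod_primes.
have tau_pl : (tau (\prod_(p <- ps ++ ls) p))%:R = T ps * T ls.
  rewrite tau_prod_primes /T ?big_cat ?natrM //=.
    by move: s_prime; rewrite !all_cat => /and3P[-> _ ->].
  move: s_uniq; rewrite /s !cat_uniq has_cat negb_or.
  by case/and3P=> -> /andP[_ ->] /and3P[].
pose X : int := (1 + (-1) ^+ sgn) * (-1) ^+ class_sign ps qs ls.
pose Y : int := 2 * ((-1) ^+ (size ps + size ls) * (\prod_(q <- qs) tau_prime q)%N%:Z).
pose Z : int := 2 * (\prod_(q <- s) tau_prime q)%N%:Z.
have S1 k : odd k -> \sum_(c < M) chr c ^+ k = X%:~R.
  move=> k_odd; rewrite (sum_class_char_odd sgn s_pr s_uniq theta_mod theta_sum k_odd).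
  by rewrite /X rmorphM rmorphD !rmorphXn !rmorphN1.
have S2 : \sum_(c < M) chr c ^+ 2 = Y%:~R.
  rewrite (sum_class_char2 sgn s_pr s_uniq theta_mod theta_sum).
  by rewrite /Y !rmorphM !rmorphXn !rmorphN1.
have S4 : \sum_(c < M) chr c ^+ 4 = Z%:~R.
  rewrite (sum_class_char4 sgn s_pr s_uniq theta_mod theta_sum).
  by rewrite /Z rmorphM.
have cardA : #|[pred c : 'I_M | admissible M a c]|%:R = Z%:~R :> R.
  rewrite -[LHS]/(#|_|%:Z%:~R); congr (_%:~R).
  apply: gauss_intr_inj; rewrite -S4 -(count_neq0 M chr_mu4).
  rewrite -[LHS]/(#|_|%:R); congr (_%:R).
  by apply: eq_card => c; rewrite !inE chr_adm.
have card1 : 4 * #|[pred c : 'I_M | chr c == 1]|%:R = (Z + X + Y + X)%:~R :> R.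
  rewrite -[4]/(4%:Z%:~R) -[#|_|%:R]/(#|_|%:Z%:~R) -rmorphM; congr (_%:~R).
  apply: gauss_intr_inj; rewrite rmorphM.
  by rewrite [LHS](count_eq1 M chr_mu4) S4 S2 !S1 // -!rmorphD.
have cardN1 : 4 * #|[pred c : 'I_M | chr c == -1]|%:R = (Z - X + Y - X)%:~R :> R.
  rewrite -[4]/(4%:Z%:~R) -[#|_|%:R]/(#|_|%:Z%:~R) -rmorphM; congr (_%:~R).
  apply: gauss_intr_inj; rewrite rmorphM.
  by rewrite [LHS](count_eqN1 M chr_mu4) S4 S2 !S1 // -rmorphB -rmorphD -rmorphB.
have ZR : Z%:~R = 2 * T s :> R by rewrite /Z rmorphM.
have YR : Y%:~R = 2 * ((-1) ^+ (size ps + size ls) * T qs) :> R.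
  by rewrite /Y !rmorphM rmorphXn rmorphN1.
have XR : X%:~R = (1 + (-1) ^+ sgn) * (-1) ^+ class_sign ps qs ls :> R.
  by rewrite /X rmorphM rmorphD !rmorphXn !rmorphN1.
have adm_gt0 : (0 < #|[pred c : 'I_M | admissible M a c]|)%N.
  by rewrite -(ltr0n R) cardA ZR mulr_gt0 // T_gt0.
have frob p x : prime p -> p%:Z = a ^+ 2 + x%:Z ^+ 2 ->
    (~~ (p%:Z %| 2 * D)%Z = (chr x != 0)) /\ (~~ (p%:Z %| 2 * D)%Z ->
    (frob_trace D p = 2 * a <-> chr x = 1) /\ (frob_trace D p = 2 * - a <-> chr x = -1)).
  move=> p_pr pE; split; first exact: (dvd_2D_class_char s_pr e_gt0 a1 DE theta_eq0).
  exact: (class_char_frob s_pr e_gt0 a1 DE theta_eq0 theta_rec).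
have dens (z : gaussint) (b : int) : z != 0 -> Qset b = Qset a ->
    (forall p x, prime p -> p%:Z = a ^+ 2 + x%:Z ^+ 2 -> ~~ (p%:Z %| 2 * D)%Z ->
       frob_trace D p = 2 * b <-> chr x = z) ->
  dens_is D b (#|[pred c : 'I_M | chr c == z]|%:R
               / #|[pred c : 'I_M | admissible M a c]|%:R : R).
  move=> z0 Qb hb; rewrite /dens_is Qb.
  apply: (density_of_classes HL M_gt0 M_even a0 (G := fun c => chr c == z)) => //.
    by move=> c /eqP cz; rewrite -chr_adm cz.
  move=> p x p_pr pE; rewrite chr_mod; have [h1 _] := frob p x p_pr pE.
  split=> [[p2D /(hb p x p_pr pE p2D) ->] //|/eqP cz].
  have p2D : ~~ (p%:Z %| 2 * D)%Z by rewrite h1 cz.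
  by split=> //; apply/(hb p x p_pr pE p2D).
have AE : A = (-1) ^+ (size ps + size ls) / (T ps * T ls) by rewrite /A tau_pl.
have BE : B = X%:~R / (T ps * T qs * T ls) by rewrite /B tau_s Ts XR.
have [ps0 qs0 ls0] := And3 (lt0r_neq0 Tps) (lt0r_neq0 Tqs) (lt0r_neq0 Tls).
split.
  have -> : 1 / 4 * (1 + A + B) = #|[pred c : 'I_M | chr c == 1]|%:R
      / #|[pred c : 'I_M | admissible M a c]|%:R.
    have -> : #|[pred c : 'I_M | chr c == 1]|%:R = (Z + X + Y + X)%:~R / 4 :> R.
      by rewrite -card1; field.
    rewrite cardA !rmorphD /= ZR YR AE BE Ts; field.
    by rewrite ps0 qs0 ls0.
  apply: dens => // p x p_pr pE p2D.
  by have [_ /(_ p2D) []] := frob p x p_pr pE.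
have -> : 1 / 4 * (1 + A - B) = #|[pred c : 'I_M | chr c == -1]|%:R
    / #|[pred c : 'I_M | admissible M a c]|%:R.
  have -> : #|[pred c : 'I_M | chr c == -1]|%:R = (Z - X + Y - X)%:~R / 4 :> R.
    by rewrite -cardN1; field.
  rewrite cardA !(rmorphD, rmorphN) /= ZR YR AE BE Ts; field.
  by rewrite ps0 qs0 ls0.
apply: dens => // [|p x p_pr pE p2D]; first by rewrite /Qset sqrrN.
by have [_ /(_ p2D) []] := frob p x p_pr pE.
Qed.

Local Close Scope classical_set_scope.

Theorem theorem3p7 (R : realType) (HL : hardy_littlewood R)
    (alpha D : int) (neg : bool) (sigma : nat) (ps qs ls : seq nat)
    (alpha_mod4 : (alpha = 1 %[mod 4])%Z)
    (sigma_le3 : (sigma <= 3)%N)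
    (odd_primes : all (fun p => prime p && odd p) (ps ++ qs ++ ls))
    (distinct : uniq (ps ++ qs ++ ls))
    (D_eq : D = (-1) ^+ neg * 2 ^+ sigma * (\prod_(p <- ps) p)%N%:Z
                * (\prod_(q <- qs) q)%N%:Z ^+ 2
                * (\prod_(l <- ls) l)%N%:Z ^+ 3)
    (D_alpha : coprimez D alpha) :
  let r := size ps in
  let s := size qs in
  let t := size ls in
  let r1 := count_mod8 1 ps in
  let r7 := count_mod8 7 ps in
  let t1 := count_mod8 1 ls in
  let t7 := count_mod8 7 ls in
  let tau_pl : R := (tau (\prod_(p <- ps ++ ls) p))%:R in
  let tau_pql : R := (tau (\prod_(p <- ps ++ qs ++ ls) p))%:R in
  let A : R := (-1) ^+ (r + t) / tau_pl in
  let B : R := 2 * (-1) ^+ (r1 + r7 + s + t1 + t7) / tau_pql in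
  ((D = 1 %[mod 4])%Z ->
     dens_is D alpha (1 / 4 * (1 + A + B)) /\
     dens_is D (- alpha) (1 / 4 * (1 + A - B))) /\
  ((D = 3 %[mod 4])%Z ->
     dens_is D alpha (1 / 4 * (1 + A)) /\
     dens_is D (- alpha) (1 / 4 * (1 + A))).
Proof.
move=> r s t r1 r7 t1 t7 tau_pl tau_pql A B.
have sigma0 : (2 %| D)%Z = false -> sigma = 0%N.
  case: sigma D_eq {sigma_le3} => // k D_eq /negP[].
  by rewrite D_eq exprS !mulrA [_ * 2]mulrC -!mulrA dvdz_mulr.
have sign_cases : (2 %| D)%Z = false -> exists sgn : bool,
    D = (-1) ^+ sgn * \prod_(q <- ps ++ qs ++ ls) qstar q ^+ prime_exponent ps qs q
    /\ (D = (-1) ^+ sgn %[mod 4])%Z.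
  move=> /sigma0 sigma0'; apply: (signed_product odd_primes distinct (neg := neg)).
  by rewrite D_eq sigma0' expr0 mulr1.
split=> D4.
  have [|[] [DE Dsgn]] := sign_cases; [by move: D4; clear; lia | |].
    by exfalso; move: D4 Dsgn; rewrite expr1; clear; lia.
  have := dens_of_sign HL alpha_mod4 odd_primes distinct D_alpha DE.
  by rewrite /= expr0.
have [|[] [DE Dsgn]] := sign_cases; [by move: D4; clear; lia | |]; last first.
  by exfalso; move: D4 Dsgn; rewrite expr0; clear; lia.
have := dens_of_sign HL alpha_mod4 odd_primes distinct D_alpha DE.
by rewrite /= expr1 addrN !mul0r addr0 subr0.
Qed.
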